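(* For $n\ge 2$ and $k\ge 0$ let $$\xi_{n,k}(\mathbf{x})=\sum_{\lambda\vdash n}c_{\lambda,k}\,s_\lambda(\mathbf{x}),$$ where $c_{\lambda,k}$ is the number of tableaux $\mathcal{P}\in\mathrm{SYT}(\lambda)$ such that $\mathrm{Asc}(\mathcal{P})\in\mathrm{Stab}([2,n-2])$ and $|\mathrm{Asc}(\mathcal{P})|=k$. For $n\ge1$ and $k\ge0$ let $$\gamma_{n,k}(\mathbf{x})=\sum_{\lambda\vdash n}d_{\lambda,k}\,s_\lambda(\mathbf{x}),$$ where $d_{\lambda,k}$ is the number of tableaux $\mathcal{P}\in\mathrm{SYT}(\lambda)$ such that $\mathrm{Asc}(\mathcal{P})\in\mathrm{Stab}([n-2])$ and $|\mathrm{Asc}(\mathcal{P})|=k$. Then $$\frac{1-t}{E(\mathbf{x};tz)-tE(\mathbf{x};z)}=1+\sum_{n\ge2}z^n\sum_{k=0}^{\lfloor(n-2)/2\rfloor}\xi_{n,k}(\mathbf{x})\,t^{k+1}(1+t)^{n-2k-2}$$ and $$\frac{(1-t)E(\mathbf{x};tz)}{E(\mathbf{x};tz)-tE(\mathbf{x};z)}=1+\sum_{n\ge1}z^n\sum_{k=0}^{\lfloor(n-1)/2\rfloor}\gamma_{n,k}(\mathbf{x})\,t^{k+1}(1+t)^{n-1-2k}.$$ Moreover, $$\xi_{n,k}(\mathbf{x})=\sum_{w}F_{n,\mathrm{Des}(w)}(\mathbf{x}),$$ where $w\in\mathfrak{S}_n$ runs through all permutations for which $\mathrm{Asc}(w^{-1})\in\mathrm{Stab}([2,n-2])$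 has $k$ elements, and $$\gamma_{n,k}(\mathbf{x})=\sum_{w}F_{n,\mathrm{Des}(w)}(\mathbf{x}),$$ where $w\in\mathfrak{S}_n$ runs through all permutations for which $\mathrm{Asc}(w^{-1})\in\mathrm{Stab}([n-2])$ has $k$ elements.
   Context: Notation: $[m]=\{1,\dots,m\}$ (empty if $m\le0$), $[a,b]=\{a,\dots,b\}$ (empty if $a>b$); $\mathrm{Stab}(\Theta)$ is the set of subsets of $\Theta\subseteq\mathbb{Z}$ containing no two consecutive integers. $\mathfrak{S}_n$ is the symmetric group of permutations of $[n]$. $\mathbf{x}=(x_1,x_2,\dots)$; $E(\mathbf{x};z)=\sum_{n\ge0}e_n(\mathbf{x})z^n$ is the generating function of the elementary symmetric functions; $s_\lambda$ are Schur functions. The identities are between formal power series in $z$ whose coefficients are polynomials in $t$ over the ring of symmetric functions. $\mathrm{SYT}(\lambda)$ is the set of standard Young tableaux of shape $\lambda$ (English notation). For $\mathcal{P}\in\mathrm{SYT}(\lambda)$, $\lambda\vdash n$, $\mathrm{Des}(\mathcal{P})$ is the set of $i\in[n-1]$ such that $i+1$ appears in $\mathcal{P}$ in a lower row than $i$, and $\mathrm{Asc}(\mathcal{P})=[n-1]\smallsetminus\mathrm{Des}(\mathcal{P})$. For $w\in\mathfrak{S}_n$, $\mathrm{Des}(w)=\{i\in[n-1]:w(i)>w(i+1)\}$ and $\mathrm{Asc}(w)=[n-1]\smallsetminus\mathrm{Des}(w)$. For $S\subseteq[n-1]$, the fundamental quasisymmetric function is $$F_{n,S}(\mathbf{x})=\sum_{\substack{1\le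 i_1\le i_2\le\cdots\le i_n\\ j\in S\Rightarrow i_j<i_{j+1}}}x_{i_1}x_{i_2}\cdots x_{i_n}.$$ *)

(* Defs.v *)
From HB Require Import structures.
From mathcomp Require Import all_boot all_order all_algebra all_fingroup.
From mathcomp Require Import finmap multiset boolp.

Set Implicit Arguments.
Unset Strict Implicit.
Unset Printing Implicit Defensive.

Import GRing.Theory.
Local Open Scope mset_scope.
Local Open Scope ring_scope.

(* Formal power series in z over a commutative ring, as coefficient sequences
   with the Cauchy product. *)
Section ZSeries.
Variable R : comNzRingType.

Definition zser : Type := nat -> R.

HB.instance Definition _ := Choice.copy zser (nat -> R).

Implicit Types f g h : zser.

Definition zzero : zser := fun=> 0.
Definition zopp f : zser := fun n => - f n.
Definition zadd f g : zser := fun n => f n + g n.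

Fact zaddA : associative zadd.
Proof. by move=> f g h; apply/funext => n; exact: addrA. Qed.
Fact zaddC : commutative zadd.
Proof. by move=> f g; apply/funext => n; exact: addrC. Qed.
Fact zadd0 : left_id zzero zadd.
Proof. by move=> f; apply/funext => n; exact: add0r. Qed.
Fact zaddN : left_inverse zzero zopp zadd.
Proof. by move=> f; apply/funext => n; exact: addNr. Qed.

HB.instance Definition _ :=
  GRing.isZmodule.Build zser zaddA zaddC zadd0 zaddN.

Definition zconst (c : R) : zser := fun n => if n == 0%N then c else 0.
Definition zone : zser := zconst 1.
Definition zmul f g : zser := fun n => \sum_(i < n.+1) f i * g (n - i)%N.

Let trunc n f : {poly R} := \poly_(i < n.+1) f i.

Let zmul_trunc n m f g :
  (m <= n)%N -> zmul f g m = (trunc n f * trunc n g)`_m.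
Proof.
move=> lemn; rewrite coefM; apply: eq_bigr => i _; rewrite !coef_poly.
by rewrite !ltnS (leq_trans (leq_subr _ _)) // (leq_trans _ lemn) // -ltnS.
Qed.

Fact zmulC : commutative zmul.
Proof.
by move=> f g; apply/funext => n; rewrite !(@zmul_trunc n) // mulrC.
Qed.

Fact zmulA : associative zmul.
Proof.
move=> f g h; apply/funext => n.
transitivity ((trunc n f * (trunc n g * trunc n h))`_n).
  rewrite coefM; apply: eq_bigr => i _; rewrite coef_poly ltn_ord.
  by rewrite (@zmul_trunc n) ?leq_subr.
rewrite mulrA coefM; apply: eq_bigr => i _.
have le_in : (i <= n)%N by rewrite -ltnS.
by rewrite (@zmul_trunc n) // coef_poly ltnS leq_subr.
Qed.

Fact zmul1 : left_id zone zmul.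
Proof.
move=> f; apply/funext => n; rewrite /zmul big_ord_recl subn0 mul1r big1 ?addr0 //.
by move=> i _; rewrite mul0r.
Qed.

Fact zmulDl : left_distributive zmul zadd.
Proof.
move=> f g h; apply/funext => n; rewrite /zmul /zadd -big_split.
by apply: eq_bigr => i _; rewrite mulrDl.
Qed.

Fact zone_neq0 : zone != zzero.
Proof. by apply/eqP => /(congr1 (@^~ 0%N))/eqP; rewrite oner_eq0. Qed.

HB.instance Definition _ := GRing.Zmodule_isComNzRing.Build zser
  zmulA zmulC zmul1 zmulDl zone_neq0.

(* \sum_(n >= m) a_n z^n *)
Definition zsum_from (m : nat) (a : nat -> R) : zser :=
  fun n => if (m <= n)%N then a n else 0.

End ZSeries.

(* c = a / b in the sense that c is the unique solution of b * q = a. *)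
Definition is_quot (R : comNzRingType) (a b c : R) : Prop :=
  forall q : R, b * q = a <-> q = c.

(* The sub-multisets of m (see mem_submsets), each listed once. *)
Definition submsets (m : {mset nat}) : seq {mset nat} :=
  undup [seq seq_mset (mask b (enum_mset m)) | b : (size (enum_mset m)).-tuple bool].

Lemma submsets_uniq m : uniq (submsets m).
Proof. exact: undup_uniq. Qed.

Lemma mem_submsets m a : (a \in submsets m) = (a `<=` m)%mset.
Proof.
rewrite mem_undup; apply/mapP/msubsetP => [[b _ ->] x|le_am].
  rewrite mset_seqE -[m in leqRHS]seq_mset_id mset_seqE.
  exact/leq_count_subseq/mask_subseq.
have /count_subseqP[s /subseqP[b szb ->] pas] :
  forall x, (count_mem x (enum_mset a) <= count_mem x (enum_mset m))%N.
  by move=> x; rewrite !count_mem_mset.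
exists (tcast szb (in_tuple b)); rewrite ?mem_enum // val_tcast /=.
by rewrite -[LHS]seq_mset_id; apply/eq_seq_msetP.
Qed.

(* Formal power series with integer coefficients in infinitely many commuting
   variables indexed by nat (the 0-based variable i is x_(i+1)).  A monomial is
   the finite multiset of the indices of its variables, and a series maps each
   monomial to its coefficient.  Symmetric and quasisymmetric functions are
   regarded as elements of this ring. *)
Definition xser : Type := {mset nat} -> int.

HB.instance Definition _ := Choice.copy xser ({mset nat} -> int).

Section XSeries.
Implicit Types f g h : xser.

Definition xzero : xser := fun=> 0.
Definition xopp f : xser := fun m => - f m.
Definition xadd f g : xser := fun m => f m + g m.

Fact xaddA : associative xadd.
Proof. by move=> f g h; apply/funext => n; exact: addrA. Qed.
Fact xaddC : commutative xadd.
Proof. by move=> f g; apply/funext => n; exact: addrC. Qed.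
Fact xadd0 : left_id xzero xadd.
Proof. by move=> f; apply/funext => n; exact: add0r. Qed.
Fact xaddN : left_inverse xzero xopp xadd.
Proof. by move=> f; apply/funext => n; exact: addNr. Qed.

HB.instance Definition _ :=
  GRing.isZmodule.Build xser xaddA xaddC xadd0 xaddN.

Definition xone : xser := fun m => (m == mset0)%:R.
Definition xmul f g : xser :=
  fun m => \sum_(a <- submsets m) f a * g (m `\` a)%mset.

Fact xmulC : commutative xmul.
Proof.
move=> f g; apply/funext => m; rewrite /xmul.
have /(perm_big _) -> : perm_eq (submsets m)
    [seq (m `\` a)%mset | a <- submsets m].
  apply: uniq_perm; rewrite ?submsets_uniq //.
    rewrite map_inj_in_uniq ?submsets_uniq // => a b.
    by rewrite !mem_submsets => /msetBBK {2}<- /msetBBK {2}<- ->.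
  move=> a; rewrite mem_submsets; apply/idP/mapP => [le_am|[b _ ->]].
    by exists (m `\` a)%mset; rewrite ?mem_submsets ?msubsetDl // msetBBK.
  exact: msubsetDl.
rewrite big_map /=; apply: eq_big_seq => a; rewrite mem_submsets => /msetBBK.
by rewrite mulrC => ->.
Qed.

Fact xmulA : associative xmul.
Proof.
move=> f g h; apply/funext => m; rewrite /xmul.
transitivity (\sum_(b <- submsets m) \sum_(a <- submsets m | (b `<=` a)%mset)
   f b * g (a `\` b)%mset * h (m `\` a)%mset); last first.
  rewrite (exchange_big_dep xpredT) //=; apply: eq_big_seq => a.
  rewrite mem_submsets => le_am; rewrite mulr_suml -big_filter.
  apply: perm_big; apply: uniq_perm; rewrite ?filter_uniq ?submsets_uniq //.
  move=> b; rewrite mem_filter !mem_submsets andb_idr // => le_ba.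
  exact: msubset_trans le_ba le_am.
apply: eq_big_seq => b; rewrite mem_submsets => le_bm; rewrite mulr_sumr.
rewrite -[RHS]big_filter.
have /(perm_big _) -> : perm_eq [seq a <- submsets m | (b `<=` a)%mset]
    [seq (b `+` c)%mset | c <- submsets (m `\` b)%mset].
  apply: uniq_perm; rewrite ?filter_uniq ?submsets_uniq //.
    by rewrite map_inj_uniq ?submsets_uniq //; exact: can_inj (msetDKB b).
  move=> a; rewrite mem_filter mem_submsets; apply/andP/mapP.
    move=> [le_ba le_am]; exists (a `\` b)%mset; rewrite ?msetBDKC //.
    by rewrite mem_submsets msetSB.
  move=> [c]; rewrite mem_submsets => le_c ->; split.
    by apply/msubsetP => x; rewrite msetE2 leq_addr.
  by rewrite -(msetBDKC le_bm) msetDS.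
rewrite big_map /=; apply: eq_bigr => c _.
by rewrite mulrA msetDKB msetBDA.
Qed.

Fact xmul1 : left_id xone xmul.
Proof.
move=> f; apply/funext => m; rewrite /xmul.
rewrite (bigD1_seq mset0) ?submsets_uniq ?mem_submsets ?msub0set //=.
rewrite /xone eqxx mul1r msetB0 big1 ?addr0 // => a /negPf->.
by rewrite mul0r.
Qed.

Fact xmulDl : left_distributive xmul xadd.
Proof.
move=> f g h; apply/funext => m; rewrite /xmul /xadd -big_split.
by apply: eq_bigr => i _; rewrite mulrDl.
Qed.

Fact xone_neq0 : xone != xzero.
Proof. by apply/eqP => /(congr1 (@^~ mset0)); rewrite /xone eqxx. Qed.

HB.instance Definition _ := GRing.Zmodule_isComNzRing.Build xser
  xmulA xmulC xmul1 xmulDl xone_neq0.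

End XSeries.

(* The series \sum_s x_(s_1) ... x_(s_n) over all words s satisfying P: the
   coefficient of a monomial counts the rearrangements of it satisfying P. *)
Definition words (P : pred (seq nat)) : xser :=
  fun m => (count P (permutations (enum_mset m)))%:R.

Definition elem (n : nat) : xser :=
  words (fun s => (size s == n) && sorted ltn s).

(* E(x; u z), for u a polynomial in t *)
Definition Eser (u : {poly xser}) : zser {poly xser} :=
  fun n => (elem n)%:P * u ^+ n.

(* Subsets of [n-1] are represented inside 'I_n = {0, ..., n-1}, without shift:
   i : 'I_n stands for the integer i. *)
Definition itv (n a b : nat) : {set 'I_n} := [set i : 'I_n | (a <= i <= b)%N].

Definition Stab (n : nat) (Theta : {set 'I_n}) : {set {set 'I_n}} :=
  [set A : {set 'I_n} | (A \subset Theta) &&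
     [forall i in A, forall j in A, j != i.+1 :> nat]].

(* The 0-based letters s_(j-1) and s_j are the 1-based letters i_j and i_(j+1) *)
Definition Fqsym (n : nat) (S : {set 'I_n}) : xser :=
  words (fun s => [&& size s == n, sorted leq s &
    [forall j in S, (nth 0 s j.-1 < nth 0 s j)%N]]).

(* w : 'S_n permutes the 0-based {0, ..., n-1}: w(i) and w(i+1) in 1-based
   notation are w (ord_pred i) and w i. *)
Definition Des (n : nat) (w : 'S_n) : {set 'I_n} :=
  [set i : 'I_n | (1 <= i)%N && (w i < w (ord_pred i))%N].

Definition Asc (n : nat) (w : 'S_n) : {set 'I_n} := itv n 1 n.-1 :\: Des w.

(* Partitions la_1 >= ... >= la_n >= 0 of n, padded with zeros to length n. *)
Definition is_part (n : nat) (la : seq nat) : bool :=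
  sorted geq la && (sumn la == n).

Definition intpart (n : nat) : finType :=
  {la : n.-tuple 'I_n.+1 | is_part n [seq val i | i <- la]}.

Definition parts (n : nat) (la : intpart n) : seq nat :=
  [seq val i | i <- val la].

(* A tableau is the list of its rows, from top to bottom (reshape la s is the
   filling of la with row reading word s); rows are sorted for r, columns are
   strictly increasing. *)
Definition tableau (r : rel nat) (T : seq (seq nat)) : bool :=
  all (sorted r) T &&
  sorted (fun u v => all (fun p => p.1 < p.2)%N (zip u v)) T.

Definition schur (la : seq nat) : xser :=
  words (fun s => (size s == sumn la) && tableau leq (reshape la s)).

Definition SYT (la : seq nat) : seq (seq (seq nat)) :=
  [seq T <- [seq reshape la s | s <- permutations (iota 1 (sumn la))]
     | tableau ltn T].

Definition row_of (T : seq (seq nat)) (i : nat) : nat :=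
  find (fun r => i \in r) T.

Definition DesT (n : nat) (T : seq (seq nat)) : {set 'I_n} :=
  [set i : 'I_n | (1 <= i)%N && (row_of T i < row_of T i.+1)%N].

Definition AscT (n : nat) (T : seq (seq nat)) : {set 'I_n} :=
  itv n 1 n.-1 :\: DesT n T.

(* The number of P in SYT(la) with Asc(P) in Stab(Theta) and |Asc(P)| = k *)
Definition nb_syt (n : nat) (Theta : {set 'I_n}) (la : seq nat) (k : nat) : nat :=
  count (fun T => (AscT n T \in Stab Theta) && (#|AscT n T| == k)) (SYT la).

Definition xi (n k : nat) : xser :=
  \sum_(la : intpart n) schur (parts la) *+ nb_syt (itv n 2 (n - 2)) (parts la) k.

Definition gamma (n k : nat) : xser :=
  \sum_(la : intpart n) schur (parts la) *+ nb_syt (itv n 1 (n - 2)) (parts la) k.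

(* Main.v *)
(* Both families are generating functions of words.  The Robinson-Schensted
   correspondence sends a word s to a pair (P, Q) of tableaux of the same shape,
   where P is semistandard with the letters of s and Q is standard with
   Asc(Q) = {i | s_i <= s_(i+1)}; hence \sum_la #{Q | Asc(Q) = A} s_la is the sum of
   all words with ascent set A.  Standardization turns the same sum of words into
   a sum of F_(n, Des(w)).

   For the power series identities, the product E(x; tz) * (series of xi) is a sum
   over words cut into a strictly decreasing prefix and a remainder.  A word counted
   by xi splits into maximal decreasing runs of length m >= 2, each of weight
   t (1 + t)^(m-2); a word counted by gamma is alike, except that its first run may
   have length 1 and weighs t (1 + t)^(m-1).  Summing over the prefix then gives,
   word by word, E(x; tz) * xi = gamma and t E(x; z) * xi = gamma - (1 - t). *)
Require Import Defs.
From HB Require Import structures.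
From mathcomp Require Import all_boot all_order all_algebra all_fingroup.
From mathcomp Require Import finmap multiset boolp.
From mathcomp Require Import zify ring.
Import GRing.Theory.

Set Implicit Arguments.
Unset Strict Implicit.
Unset Printing Implicit Defensive.

(** * Row insertion *)

(** [zip] truncates to the shorter row, so the condition on sizes is what makes the shape a
    partition. *)
Definition col_strict (u v : seq nat) :=
  (size v <= size u) && all (fun p => p.1 < p.2) (zip u v).

Lemma col_strictP u v :
  reflect (size v <= size u /\ forall i, i < size v -> nth 0 u i < nth 0 v i)
    (col_strict u v).
Proof.
apply: (iffP andP) => -[le_vu H]; split=> //.
  move=> i ltiv; move/(all_nthP (0, 0)): H => /(_ i).
  by rewrite size_zip (minn_idPr le_vu) nth_zip_cond size_zip (minn_idPr le_vu) ltiv;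
    exact.
apply/(all_nthP (0, 0)) => i; rewrite size_zip (minn_idPr le_vu) => lti.
by rewrite nth_zip_cond size_zip (minn_idPr le_vu) lti; exact: H.
Qed.

Definition ssyt (r : rel nat) (T : seq (seq nat)) :=
  all (sorted r) T && sorted col_strict T.

(** Schensted row insertion. The index returned is the row that gains a box, which the recording
    tableau needs. *)
Fixpoint ins (T : seq (seq nat)) (x : nat) : seq (seq nat) * nat :=
  if T is r :: T' then
    let j := find (ltn x) r in
    if j < size r then
      let: (U, i) := ins T' (nth 0 r j) in (set_nth 0 r j x :: U, i.+1)
    else (rcons r x :: T', 0)
  else ([:: [:: x]], 0).

(** Reverse row insertion from the end of row [i]: going up, [y] replaces the rightmost entry
    smaller than [y], and the entry expelled from the top row is returned. A row that becomes empty
    stays. *)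
Fixpoint del (T : seq (seq nat)) (i : nat) : seq (seq nat) * nat :=
  match T, i with
  | [::], _ => ([::], 0)
  | r :: T', 0 => (take (size r).-1 r :: T', last 0 r)
  | r :: T', i'.+1 =>
    let: (U, y) := del T' i' in
    let j := (find (leq y) r).-1 in (set_nth 0 r j y :: U, nth 0 r j)
  end.

Lemma sorted_leqP s :
  reflect (forall i j, i <= j -> j < size s -> nth 0 s i <= nth 0 s j) (sorted leq s).
Proof.
apply: (iffP idP) => [ss i j leij ltj|H]; last first.
  by apply/(sortedP 0) => i lti; apply: H.
by apply: (sorted_leq_nth leq_trans leqnn) => //; rewrite inE; lia.
Qed.

Lemma find_eq (a : pred nat) s j : j < size s -> a (nth 0 s j) ->
  (forall i, i < j -> ~~ a (nth 0 s i)) -> find a s = j.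
Proof.
move=> ltj aj H; apply/eqP; rewrite eqn_leq; apply/andP; split.
  by rewrite leqNgt; apply/negP => /(before_find 0); rewrite aj.
rewrite leqNgt; apply/negP => lt; have := H _ lt.
by rewrite nth_find // has_find; lia.
Qed.

Lemma size_ins T x U i : ins T x = (U, i) ->
  [/\ i <= size T, size U = maxn (size T) i.+1 & map size U = incr_nth (map size T) i].
Proof.
elim: T x U i => [|r T IH] x U i /=; first by case=> <- <-.
case: ltnP => [ltj|_]; last by case=> <- <-; rewrite /= size_rcons maxnSS maxn0.
case E: ins => [U' i'] [<- <-]; have [le_i sU shU] := IH _ _ _ E.
rewrite /= size_set_nth (maxn_idPr ltj) shU sU; split=> //; lia.
Qed.

Lemma count_set_nth_add (a : pred nat) s j x : j < size s ->
  count a (set_nth 0 s j x) + a (nth 0 s j) = a x + count a s.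
Proof.
move=> ltj; rewrite count_set_nth_ltn //.
have : a (nth 0 s j) <= count a s
  by rewrite -{2}(cat_take_drop j s) count_cat (drop_nth 0) //=; lia.
lia.
Qed.

Lemma perm_ins T x U i : ins T x = (U, i) -> perm_eq (flatten U) (x :: flatten T).
Proof.
elim: T x U i => [|r T IH] x U i /=; first by case=> <- _.
case: ltnP => [ltj|_]; last first.
  by case=> <- _; rewrite /= -cats1 -!catA perm_catCA.
case E: ins => [U' i'] [<- _] /=; have /seq.permP pe := IH _ _ _ E.
apply/seq.permP => a; have /= := pe a; rewrite /= !count_cat.
have := count_set_nth_add a x ltj; lia.
Qed.

Lemma set_nth_size s x : set_nth 0 s (size s) x = rcons s x.
Proof. by elim: s => //= y s ->. Qed.

Lemma set_nthK s j x : j < size s -> set_nth 0 (set_nth 0 s j x) j (nth 0 s j) = s.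
Proof.
move=> ltj; rewrite set_set_nth eqxx; apply: (@eq_from_nth _ 0).
  by rewrite size_set_nth; lia.
by move=> i _; rewrite nth_set_nth /=; case: eqP => [->|].
Qed.

Lemma find_none (a : pred nat) (s : seq nat) :
  (forall k, k < size s -> ~~ a (nth 0 s k)) -> find a s = size s.
Proof. by move=> H; apply/hasNfind/hasPn => _ /(nthP 0)[k /H ? <-]. Qed.

Lemma find_gt_pred s j y : j < size s -> (forall k, k <= j -> nth 0 s k < y) ->
  (forall k, j < k < size s -> y <= nth 0 s k) -> (find (leq y) s).-1 = j.
Proof.
move=> ltj lo hi; suff -> : find (leq y) s = j.+1 by [].
have [ltj1|gej1] := ltnP j.+1 (size s).
  by apply: find_eq => // [|k ltk]; [apply: hi; lia | rewrite -ltnNge lo].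
have -> : j.+1 = size s by lia.
by apply: find_none => k ltk; rewrite -ltnNge lo //; lia.
Qed.

Lemma find_leq (a : pred nat) s j : j < size s -> a (nth 0 s j) -> find a s <= j.
Proof. by move=> ltj aj; rewrite leqNgt; apply/negP => /(before_find 0); rewrite aj. Qed.

Lemma ssyt_cons e r T :
  ssyt e (r :: T) =
  [&& sorted e r, (if T is r' :: _ then col_strict r r' else true) & ssyt e T].
Proof. by rewrite /ssyt /=; case: T => [|r' T] /=; rewrite ?andbT //;
  case: (sorted e r); case: (sorted e r'); case: (all _ _); case: (col_strict _ _). Qed.

(* The bumping position is weakly left of the one in the row above. *)
Lemma ssyt_ins T x U i : ssyt leq T -> ins T x = (U, i) ->
  ssyt leq U /\ head [::] U = set_nth 0 (head [::] T) (find (ltn x) (head [::] T)) x.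
Proof.
elim: T x U i => [|r T IH] x U i; first by move=> _ [<- _].
rewrite ssyt_cons => /and3P[/sorted_leqP sr cT sT] /=.
have xlt j : j < find (ltn x) r -> nth 0 r j <= x.
  by move/(before_find 0) => /= /negbT; rewrite -leqNgt.
case: ltnP => [ltj|gej]; last first.
  (* [set_nth] at index [size r] appends, so the formula for the first row covers this case. *)
  have ej : find (ltn x) r = size r by have := find_size (ltn x) r; lia.
  case=> <- _ /=; split; last by rewrite ej set_nth_size.
  rewrite ssyt_cons sT andbT; apply/andP; split.
    apply/sorted_leqP => a b; rewrite size_rcons ltnS => leab ltb.
    rewrite !nth_rcons; case: (ltngtP b (size r)) ltb => // [ltb|eb] _.
      by rewrite (leq_ltn_trans leab ltb) sr.
    by case: (ltngtP a (size r)) => // lta; apply: xlt; lia.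
  case: (T) cT => // r' T' /col_strictP[lesz H]; apply/col_strictP; rewrite size_rcons;
    split; first lia.
  by move=> a lta; rewrite nth_rcons (leq_trans lta lesz) H.
set j := find _ _ in ltj xlt *.
have xj : x < nth 0 r j by rewrite -[_ < _]/(ltn x _) nth_find ?has_find.
case E: ins => [U' i'] [<- _] /=; have [sU hU] := IH _ _ _ sT E.
split=> //; rewrite ssyt_cons sU andbT; apply/andP; split.
  apply/sorted_leqP => a b; rewrite size_set_nth (maxn_idPr ltj) => leab ltb.
  rewrite !nth_set_nth /=; case: eqVneq => [ea|na]; case: eqVneq => [eb|nb] //.
  - by apply: leq_trans (ltnW xj) _; apply: sr; lia.
  - by apply: xlt; lia.
  - exact: sr.
set h := head [::] T in hU.
have ch : col_strict r h by rewrite /h; case: (T) cT => // _; apply/col_strictP.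
suff: col_strict (set_nth 0 r j x) (head [::] U') by case: (U').
rewrite hU; move/col_strictP: ch => [lesz H].
set y := nth 0 r j in xj *; set j2 := find _ _.
(* The entry under [y], in column [j], exceeds [y]; if there is none, the length of [h] already
   bounds [j2] by [j]. *)
have lej2 : j2 <= j.
  have [ltjh|] := ltnP j (size h); first exact: find_leq ltjh (H _ ltjh).
  by have := find_size (ltn y) h; rewrite -/j2; lia.
have lej2h : j2 <= size h := find_size _ _.
apply/col_strictP; rewrite !size_set_nth; split=> [|a lta]; first lia.
rewrite !nth_set_nth /=; case: (eqVneq a j) => [ea|na]; case: (eqVneq a j2) => [eb|nb] //.
- by apply: ltn_trans xj _; rewrite /y -ea; apply: H; lia.
- by apply: leq_ltn_trans xj; apply: xlt; lia.
- by apply: H; lia.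
Qed.

(** After [x] has bumped [y] from column [j], the entries up to [j] are smaller than [y] and the
    later ones are at least [y], so the reverse step picks [j] again. The bound on [i] excludes
    insertions that open a new row, which [del] would leave behind empty. *)
Lemma del_ins T x U i : ssyt leq T -> ins T x = (U, i) -> i < size T -> del U i = (T, x).
Proof.
elim: T x U i => [|r T IH] x U i //.
rewrite ssyt_cons => /and3P[/sorted_leqP sr cT sT] /=.
case: ltnP => [ltj|gej]; last first.
  by case=> <- <- _ /=; rewrite size_rcons /= -cats1 take_size_cat // last_cat.
set j := find _ _ in ltj *.
have xj : x < nth 0 r j by rewrite -[_ < _]/(ltn x _) nth_find ?has_find.
have xlt k : k < j -> nth 0 r k <= x.
  by move/(before_find 0) => /= /negbT; rewrite -leqNgt.
case E: ins => [U' i'] [<- <-] /=; rewrite ltnS => lti.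
rewrite (IH _ _ _ sT E lti).
rewrite (@find_gt_pred _ j).
- by rewrite nth_set_nth /= eqxx set_nthK.
- by rewrite size_set_nth; lia.
- by move=> k lek; rewrite nth_set_nth /=; case: eqVneq => // nk;
  apply: leq_ltn_trans xj; apply: xlt; lia.
- move=> k; rewrite size_set_nth nth_set_nth /= => ltk; case: eqVneq => [?|nk]; first lia.
  apply: sr; lia.
Qed.

(* The entry extracted from the top row sits weakly left of the entry that it
   will extract from the row above. *)
Lemma ssyt_del T i sh U x : ssyt leq T -> sorted geq sh -> map size T = incr_nth sh i ->
  i < size T -> size sh = size T -> del T i = (U, x) ->
  [/\ ssyt leq U, map size U = sh, ins U x = (T, i), perm_eq (x :: flatten U) (flatten T) &
   let h := head [::] T in let h' := head [::] U in
   exists j, [/\ j < size h, x = nth 0 h j, size h' <= size h,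
     forall k, k < size h' -> nth 0 h k <= nth 0 h' k &
     forall k, j <= k < size h' -> x < nth 0 h' k]].
Proof.
elim: T i sh U x => [|r T IH] i [|a sh] U x //.
rewrite ssyt_cons => /and3P[/sorted_leqP sr cT sT] /=.
case: i => [|i] /= pash [sz eT] lti szT.
  have gt0 : 0 < size r by rewrite sz.
  rewrite sz /= => -[<- <-].
  have last_r : last 0 r = nth 0 r a by rewrite (last_nth 0) sz.
  have lta : a < size r by rewrite sz.
  split.
  - rewrite ssyt_cons sT andbT; apply/andP; split.
      by apply: take_sorted; apply/sorted_leqP.
    (* Since [sh] is a partition, the next row has at most [a] boxes, so nothing lies under the
       removed one. *)
    case: (T) cT eT => // r2 T2 /col_strictP[le H];
      case: (sh) pash => //= b sh' /andP[leba _] [sz2 _].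
    apply/col_strictP; rewrite size_takel; last lia; split; first lia.
    by move=> k ltk; rewrite nth_take; [apply: H|lia].
  - by rewrite /= size_takel ?sz // eT.
  - rewrite /= last_r find_none; last first.
      move=> k; rewrite size_takel; last lia.
      by move=> ltk; rewrite nth_take //= -leqNgt; apply: sr; lia.
    by rewrite ltnn -take_nth // -sz take_size.
  - rewrite /= last_r.
    have {3}-> : r = rcons (take a r) (nth 0 r a) by rewrite -take_nth // -sz take_size.
    by rewrite -cats1 -catA perm_sym perm_catCA.
  - have szt : size (take a r) = a by rewrite size_takel // sz.
    exists a; split=> //=; rewrite ?szt //.
      by move=> k ltk; rewrite nth_take.
    by move=> k /andP[lek ltk]; lia.
case E: del => [V y] [<- <-].
case: szT => szT.
have [sV shV insV pV [j [ltj ey leh leV ltV]]] :=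
  IH _ _ _ _ sT (path_sorted pash) eT lti szT E.
set h := head [::] T in ltj ey leh leV ltV; set h' := head [::] V in leh leV ltV.
have /col_strictP[lehr ltrh] : col_strict r h by rewrite /h; case: (T) cT => // _;
  apply/col_strictP.
set m := (find (leq y) r).-1.
(* [y] comes from column [j] of the row below, so the entry of [r] above it is smaller: some entry
   of [r] can be replaced, and [m] is the last such. *)
have [ltm lo hi] : [/\ m < size r, forall k, k <= m -> nth 0 r k < y &
                    forall k, m < k < size r -> y <= nth 0 r k].
  have rj : nth 0 r j < y by rewrite ey ltrh.
  have ltjf : j < find (leq y) r.
    rewrite ltnNge; apply/negP => le; have ltf : find (leq y) r < size r by lia.
    have : leq y (nth 0 r (find (leq y) r)) by rewrite nth_find // has_find.
    by have := sr _ _ le (leq_trans ltj lehr); lia.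
  have lef := find_size (leq y) r.
  split; rewrite ?/m; first lia.
    move=> k lek; have /(before_find 0)/= : k < find (leq y) r by lia.
    by move/negbT; rewrite -ltnNge.
  move=> k /andP[ltk ltkr]; have ltf : find (leq y) r < size r by lia.
  apply: leq_trans (sr (find (leq y) r) k _ _); try lia.
  by rewrite -[_ <= _]/(leq y _) nth_find // has_find.
have lejm : j <= m.
  by have rj : nth 0 r j < y by [rewrite ey ltrh]; rewrite leqNgt; apply/negP => lt;
    have := hi j; lia.
split=> /=.
- rewrite ssyt_cons sV andbT; apply/andP; split.
    apply/sorted_leqP => b c; rewrite size_set_nth (maxn_idPr ltm) => lebc ltc.
    rewrite !nth_set_nth /=; case: (eqVneq b m) => [eb|nb];
      case: (eqVneq c m) => [ec|nc] //.
    + by apply: hi; lia.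
    + by apply: ltnW; apply: lo; lia.
    + exact: sr.
  suff: col_strict (set_nth 0 r m y) h' by rewrite /h'; case: (V).
  apply/col_strictP; rewrite size_set_nth; split; first lia.
  move=> k ltk; rewrite nth_set_nth /=; case: (eqVneq k m) => [ek|nk].
    by apply: ltV; lia.
  by apply: leq_trans (leV _ ltk); apply: ltrh; lia.
- by rewrite size_set_nth (maxn_idPr ltm) shV sz.
- have -> : find (ltn (nth 0 r m)) (set_nth 0 r m y) = m.
    apply: find_eq; first by rewrite size_set_nth; lia.
      by rewrite nth_set_nth /= eqxx lo.
    by move=> k ltk; rewrite nth_set_nth /= ltn_eqF // -leqNgt; apply: sr; lia.
  by rewrite size_set_nth leq_max ltnSn /= nth_set_nth /= eqxx insV set_nthK.
- move/seq.permP: pV => pV; apply/seq.permP => p; have := pV p; rewrite /= !count_cat.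
  by have := count_set_nth_add p y ltm; lia.
- exists m; rewrite size_set_nth (maxn_idPr ltm); split=> // k.
    move=> ltk; rewrite nth_set_nth /=; case: (eqVneq k m) => [->|//];
      exact: ltnW (lo _ _).
  move=> /andP[lek ltk]; rewrite nth_set_nth /=; case: (eqVneq k m) => [ek|nk];
    first exact: lo.
  by apply: leq_trans (lo m (leqnn m)) _; apply: hi; lia.
Qed.

(** Row bumping lemma, by induction down the rows. If [x <= x'], the second insertion bumps strictly
    to the right of the first, and the bumped letters are again weakly increasing. If [x' < x], it
    bumps weakly to the left, and the second bumped letter is again the smaller one. *)
Lemma ins_ascent T x x' U V i i' : all (sorted leq) T ->
  ins T x = (U, i) -> ins U x' = (V, i') -> (i' <= i) = (x <= x').
Proof.
elim: T x x' U V i i' => [|r T IH] x x' U V i i' /=.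
  move=> _ [<- <-] /=; by rewrite (leqNgt x); case: (x' < x) => /= -[_ <-].
move=> /andP[/sorted_leqP sr sT].
case: ltnP => [ltj|gej]; last first.
  case=> <- <- /=; case: (leqP x x') => [le|lt].
    rewrite find_none ?ltnn => [[_ <-] //|k].
    rewrite size_rcons nth_rcons /= -leqNgt => ltk;
      case: (ltngtP k (size r)) ltk => // ltk _.
    have /(before_find 0) /= /negbT : k < find (ltn x) r by exact: leq_trans ltk gej.
    by rewrite -leqNgt => /leq_trans; apply.
  have -> : find (ltn x') (rcons r x) < size (rcons r x).
    by rewrite -has_find has_rcons /= lt.
  by case: ins => U' k [_ <-].
set j := find _ _ in ltj *.
have xj : x < nth 0 r j by rewrite -[_ < _]/(ltn x _) nth_find ?has_find.
have xlt k : k < j -> nth 0 r k <= x.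
  by move/(before_find 0) => /= /negbT; rewrite -leqNgt.
case E: ins => [U' k] [<- <-] /=; rewrite size_set_nth (maxn_idPr ltj).
set j' := find _ (set_nth _ _ _ _).
have nx : nth 0 (set_nth 0 r j x) j = x by rewrite nth_set_nth /= eqxx.
case: (ltnP j' (size r)) => [ltj'|gej'].
  case E': ins => [V' k'] [_ <-]; rewrite ltnS.
  rewrite (IH _ _ _ _ _ _ sT E E').
  have xj' : x' < nth 0 (set_nth 0 r j x) j'.
    by rewrite -[_ < _]/(ltn x' _) nth_find // has_find size_set_nth; lia.
  have xlt' l : l < j' -> nth 0 (set_nth 0 r j x) l <= x'.
    by move/(before_find 0) => /= /negbT; rewrite -leqNgt.
  move: xj' xlt'; rewrite nth_set_nth /= => xj' xlt'.
  case: (leqP x x') => [le|lt].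
    have ltjj' : j < j'.
      rewrite ltnNge; apply/negP => le'; move: xj'; case: (eqVneq j' j) => [ej|nj];
        first lia.
      by have := xlt j'; lia.
    rewrite gtn_eqF //; apply: sr; lia.
  have lej'j : j' <= j.
    by rewrite leqNgt; apply/negP => lt'; have := xlt' _ lt'; rewrite nx; lia.
  apply/negbTE; rewrite -ltnNge; case: (eqVneq j' j) => [//|nj].
  by apply: leq_ltn_trans xj; apply: xlt; lia.
case=> _ <-; symmetry; have := @before_find _ 0 (ltn x') (set_nth 0 r j x) j.
by rewrite -/j' nx /= => H; rewrite leqNgt; apply/negbT/H; lia.
Qed.

(** * Standard tableaux *)

Definition addbox (Q : seq (seq nat)) (i k : nat) :=
  set_nth [::] Q i (rcons (nth [::] Q i) k).

Lemma shape_addbox Q i k : i < size Q ->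
  map size (addbox Q i k) = incr_nth (map size Q) i.
Proof.
rewrite /addbox; elim: Q i => [|r Q IH] [|i] //= lti; first by rewrite size_rcons.
by rewrite IH.
Qed.

Lemma perm_addbox Q i k : i < size Q -> perm_eq (flatten (addbox Q i k)) (k :: flatten Q).
Proof.
elim: Q i => [|r Q IH] [|i] //=.
  by rewrite -cats1 -catA perm_catCA.
move=> /IH pe; rewrite -cat1s perm_sym perm_catCA perm_cat2l perm_sym; exact: pe.
Qed.

Lemma row_of_addbox_neq Q i k j : i < size Q -> j != k ->
  row_of (addbox Q i k) j = row_of Q j.
Proof.
rewrite /row_of /addbox => lti njk; elim: Q i lti => [|r Q IH] [|i] //= lti.
  by rewrite mem_rcons inE (negPf njk).
by rewrite -/(addbox Q i k) IH.
Qed.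

Lemma row_of_addbox Q i k : i < size Q -> k \notin flatten Q ->
  row_of (addbox Q i k) k = i.
Proof.
rewrite /row_of /addbox; elim: Q i => [|r Q IH] [|i] //= lti;
  rewrite mem_cat negb_or => /andP[kr kQ].
  by rewrite mem_rcons inE eqxx.
by rewrite (negPf kr) IH.
Qed.

Lemma addbox_inj i k Q1 Q2 : size Q1 = size Q2 ->
  addbox Q1 i k = addbox Q2 i k -> Q1 = Q2.
Proof.
move=> eqs e; apply: (@eq_from_nth _ [::]) => // j _.
have := congr1 (nth [::] ^~ j) e; rewrite !nth_set_nth /=.
by case: eqP => // -> /rcons_inj[].
Qed.

Lemma col_strict_rcons u v k : col_strict u v -> size v < size u -> all (gtn k) u ->
  col_strict u (rcons v k).
Proof.
move=> /col_strictP[le H] lt /(all_nthP 0) uk; apply/col_strictP; rewrite size_rcons;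
  split=> // i lti.
rewrite nth_rcons; move: lti; rewrite ltnS leq_eqVlt.
have [-> _|_ /= ltiv] := eqVneq i (size v); last by rewrite ltiv H.
by rewrite ltnn; exact: uk.
Qed.

Lemma col_strict_rconsl u v k : col_strict u v -> col_strict (rcons u k) v.
Proof.
move=> /col_strictP[le H]; apply/col_strictP; rewrite size_rcons; split=> [|i lti];
  first lia.
by rewrite nth_rcons (leq_trans lti le) H.
Qed.

Lemma sorted_ltn_rcons r k : sorted ltn (rcons r k) = sorted ltn r && all (gtn k) r.
Proof. by rewrite !(sorted_pairwise ltn_trans) pairwise_rcons andbC. Qed.

Lemma sorted_ltnE r : sorted ltn r -> forall k, k \in r -> all (geq k) r ->
  exists2 r0, r = rcons r0 k & sorted ltn r0 && all (gtn k) r0.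
Proof.
elim/last_ind: r => // r x _ sr k; rewrite mem_rcons inE all_rcons /= => kr /andP[lexk _].
move: sr; rewrite sorted_ltn_rcons => /andP[sr rx].
exists r; last by case/orP: kr => [/eqP->|/(allP rx)/= ltk]; [rewrite sr | lia].
by case/orP: kr => [/eqP->//|/(allP rx)/= ltk]; lia.
Qed.

Lemma ssyt_addbox Q i k : ssyt ltn Q -> all (gtn k) (flatten Q) -> i < size Q ->
  sorted geq (incr_nth (map size Q) i) -> ssyt ltn (addbox Q i k).
Proof.
elim: Q i => [|r Q IH] i //; rewrite !ssyt_cons /= all_cat.
move=> /and3P[sr cQ sQ] /andP[rk Qk].
case: i => [_ _|i lti] /=; rewrite /addbox /= ssyt_cons.
  rewrite sorted_ltn_rcons sr rk sQ andbT /=; case: (Q) cQ => // r2 Q2.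
  by rewrite andbT; exact: col_strict_rconsl.
move=> pQ; rewrite sr -/(addbox Q i k) IH // ?(path_sorted pQ) // andbT /=.
case: Q cQ {IH sQ Qk} lti pQ => // r2 Q2 c2; case: i => //= _ /andP[le _].
exact: col_strict_rcons.
Qed.

(** The maximal entry ends its row and has no box under it, since entries to its right or below
    would be larger. *)
Lemma ssyt_delbox Q k : ssyt ltn Q -> all (geq k) (flatten Q) ->
  count_mem k (flatten Q) = 1 -> exists Q' i,
  [/\ ssyt ltn Q', i < size Q, size Q' = size Q, Q = addbox Q' i k & k \notin flatten Q'].
Proof.
elim: Q => [|r Q IH] //; rewrite ssyt_cons /= all_cat count_cat.
move=> /and3P[sr cQ sQ] /andP[rk Qk] cnt.
have [kr|kr] := boolP (k \in r).
  have [r0 er /andP[sr0 r0k]] := sorted_ltnE sr kr rk.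
  have kr0 : k \notin r0 by apply/negP => /(allP r0k) /=; rewrite ltnn.
  have kQ : k \notin flatten Q.
    apply/count_memPn; move: cnt; rewrite er -cats1 count_cat /= eqxx; lia.
  exists (r0 :: Q), 0; split; rewrite /addbox ?er //=;
    last by rewrite mem_cat negb_or kr0.
  rewrite ssyt_cons sr0 sQ andbT /=;
    case: Q cQ Qk {IH sQ cnt} kQ => // r2 Q2 /col_strictP[le H] Qk kQ.
  move: le H; rewrite er size_rcons => le H; apply/col_strictP.
  have ne : size r2 <= size r0.
    rewrite leqNgt; apply/negP => lt.
    have := H _ lt; rewrite nth_rcons ltnn eqxx ltnNge.
    have : nth 0 r2 (size r0) \in flatten (r2 :: Q2) by rewrite mem_cat mem_nth.
    by move/(allP Qk) => /= ->.
  by split=> // i lti; have := H i lti; rewrite nth_rcons (leq_trans lti ne).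
move: cnt; rewrite (count_memPn kr) add0n => cnt.
have [Q' [i [sQ' lti sz eQ kQ']]] := IH sQ Qk cnt.
exists (r :: Q'), i.+1; split=> //=; rewrite ?sz //; last by rewrite mem_cat negb_or kr.
  rewrite ssyt_cons sr sQ' andbT /=; case: Q' eQ {sQ' kQ'} sz => // r2 Q2 eQ sz.
  move: cQ; rewrite eQ; case: (i) => //= /col_strictP[]; rewrite size_rcons => le H.
  apply/col_strictP; split=> [|j ltj]; first lia.
  by have := H j; rewrite nth_rcons ltj => H'; apply: H'; lia.
by rewrite /addbox /= -/(addbox Q' i k) -eQ.
Qed.

Definition std_tableau n Q := ssyt ltn Q && perm_eq (flatten Q) (iota 1 n).

Lemma iota1_rcons n : iota 1 n.+1 = rcons (iota 1 n) n.+1.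
Proof. by rewrite -[in LHS](addn1 n) iotaD add1n cats1. Qed.

Lemma std_tableau_addbox n Q i : std_tableau n Q -> i < size Q ->
  sorted geq (incr_nth (map size Q) i) -> std_tableau n.+1 (addbox Q i n.+1).
Proof.
move=> /andP[sQ pQ] lti gQ; rewrite /std_tableau ssyt_addbox //.
  rewrite iota1_rcons; apply: perm_trans (perm_addbox _ lti) _.
  by rewrite perm_sym perm_rcons perm_cons perm_sym.
by apply/allP => x; rewrite (perm_mem pQ) mem_iota /=; lia.
Qed.

Lemma std_tableau_delbox n Q : std_tableau n.+1 Q -> exists Q' i,
  [/\ std_tableau n Q', i < size Q, size Q' = size Q, Q = addbox Q' i n.+1 &
    i = row_of Q n.+1].
Proof.
move=> /andP[sQ pQ].
have [||Q' [i [sQ' lti sz eQ kQ]]] := @ssyt_delbox Q n.+1 sQ.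
- by apply/allP => x; rewrite (perm_mem pQ) mem_iota /=; lia.
- by rewrite (seq.permP pQ) count_uniq_mem ?iota_uniq // mem_iota; lia.
exists Q', i; split=> //; last by rewrite eQ row_of_addbox ?sz.
rewrite /std_tableau sQ' /=; move: pQ; rewrite eQ => pQ.
rewrite -(perm_cons n.+1);
  apply: perm_trans (_ : perm_eq _ (flatten (addbox Q' i n.+1))) _.
  by rewrite perm_sym perm_addbox ?sz.
by apply: perm_trans pQ _; rewrite iota1_rcons perm_rcons.
Qed.

Lemma ssyt_shape e T : ssyt e T -> sorted geq (map size T).
Proof.
move=> /andP[_ cT]; rewrite sorted_map; apply: sub_sorted cT => u v /col_strictP[] //.
Qed.

(** * The Robinson-Schensted correspondence *)

(* The word is read from right to left. *)
Fixpoint rs (L : nat) (s : seq nat) : seq (seq nat) * seq (seq nat) :=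
  if s is x :: s' then
    let: (P, Q) := rs L s' in
    let: (P', i) := ins P x in (P', addbox Q i (size s))
  else (nseq L [::], nseq L [::]).

(** [rs] starts from [L] empty rows, matching the zero-padded [parts]. While fewer than [L] letters
    are present some row is empty, so insertion never leaves the [L] rows. *)
Lemma has_nilp (T : seq (seq nat)) : size (flatten T) < size T -> has (@nilp nat) T.
Proof.
apply: contraLR => /hasPn H; rewrite -leqNgt; elim: T H => //= r T IH H.
rewrite size_cat; have := H r (mem_head _ _); rewrite /nilp.
have := IH (fun z zT => H z (mem_behead (s := r :: T) zT)); lia.
Qed.

Lemma ins_lt T x U i : has (@nilp nat) T -> ins T x = (U, i) -> i < size T.
Proof.
elim: T x U i => [|r T IH] x U i //= hT; case: ifP => [lt|_ [_ <-] //].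
case E: ins => [V j] [_ <-]; rewrite ltnS; apply: IH E.
by case/orP: hT => // /nilP er; move: lt; rewrite er.
Qed.

Lemma rs_spec L s P Q : size s <= L -> rs L s = (P, Q) ->
  [/\ ssyt leq P, std_tableau (size s) Q, map size P = map size Q, size P = L &
      perm_eq (flatten P) s].
Proof.
elim: s P Q => [|x s IH] P Q /=.
  have fl : flatten (nseq L [::]) = [::] :> seq nat by elim: L.
  have ss e : ssyt e (nseq L [::]) by elim: (L) => [|[|k] H] //; rewrite ssyt_cons H.
  by move=> _ [<- <-]; split; rewrite /std_tableau ?ss ?fl ?size_nseq.
move=> ltL; case E: rs => [P' Q']; case E': ins => [U i] [<- <-].
have [sP sQ sh sz pP] := IH _ _ (ltnW ltL) E.
have lti : i < size P'.
  by apply: ins_lt E'; apply: has_nilp; rewrite (perm_size pP) sz.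
have szQ : size Q' = size P' by rewrite -(size_map size P') sh size_map.
have [_ sU shU] := size_ins E'; have [sU' _] := ssyt_ins sP E'.
split=> //.
- by apply: std_tableau_addbox; rewrite ?szQ // -sh -shU; exact: ssyt_shape sU'.
- by rewrite shU sh shape_addbox ?szQ.
- by rewrite sU -sz; apply/maxn_idPl.
- by apply: perm_trans (perm_ins E') _; rewrite perm_cons.
Qed.

Lemma rs_addbox_lt L s x P Q U i : size s < L -> rs L s = (P, Q) -> ins P x = (U, i) ->
  i < size P /\ size Q = size P.
Proof.
move=> ltL E E'; have [sP sQ sh sz pP] := rs_spec (ltnW ltL) E; split.
  by apply: ins_lt E'; apply: has_nilp; rewrite (perm_size pP) sz.
by rewrite -(size_map size P) sh size_map.
Qed.

Lemma std_tableau_mem n Q k : std_tableau n Q -> (k \in flatten Q) = (0 < k <= n).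
Proof. by case/andP => _ /perm_mem->; rewrite mem_iota add1n ltnS. Qed.

(** The row of the largest entry of the recording tableau tells where the last insertion ended, so
    [del] recovers the last letter and the previous pair. *)
Lemma rs_inj L s t : size s = size t -> size s <= L -> rs L s = rs L t -> s = t.
Proof.
elim: s t => [|x s IH] [|y t] //= [est] ltL.
case E1: (rs L s) => [P1 Q1]; case E2: (rs L t) => [P2 Q2].
case I1: (ins P1 x) => [U1 i1]; case I2: (ins P2 y) => [U2 i2] [eU eQ].
have ltL2 : size t < L by rewrite -est.
have [lt1 sz1] := rs_addbox_lt ltL E1 I1.
have [lt2 sz2] := rs_addbox_lt ltL2 E2 I2.
have [sP1 sQ1 sh1 szP1 _] := rs_spec (ltnW ltL) E1.
have [sP2 sQ2 sh2 szP2 _] := rs_spec (ltnW ltL2) E2.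
have ei : i1 = i2.
  rewrite -[LHS](@row_of_addbox Q1 _ (size s).+1) ?sz1 ?(std_tableau_mem _ sQ1) ?ltnn ?andbF //.
  by rewrite eQ est row_of_addbox ?sz2 // (std_tableau_mem _ sQ2) ltnn andbF.
have := del_ins sP2 I2 lt2; rewrite -ei -eU (del_ins sP1 I1 lt1) => -[eP ex].
congr (_ :: _) => //; apply: IH => //; first exact: ltnW.
rewrite E1 E2 eP; congr pair; apply: (@addbox_inj i1 (size s).+1).
  by rewrite sz1 sz2 szP1.
by rewrite eQ est ei.
Qed.

(** Remove the largest entry of [Q] and reverse-insert in [P] from its row; the expelled letter is
    the first letter of the word. *)
Lemma rs_surj L n P Q : n <= L -> ssyt leq P -> std_tableau n Q ->
  map size P = map size Q ->
  size P = L -> exists2 s, size s = n & rs L s = (P, Q).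
Proof.
elim: n P Q => [|n IH] P Q ltL sP sQ sh sz.
  have nil (T : seq (seq nat)) : size T = L -> flatten T = [::] -> T = nseq L [::].
    by move=> <-; elim: T => //= r T IHT; case: r => //= /IHT {1}->.
  have szf : size (flatten P) = size (flatten Q) by rewrite !size_flatten /shape sh.
  have fQ : flatten Q = [::] by case/andP: sQ => _ /perm_nilP.
  have fP : flatten P = [::] by apply: size0nil; rewrite szf fQ.
  have szQ : size Q = L by rewrite -sz -(size_map size P) sh size_map.
  have eP := nil P sz fP; have eQ := nil Q szQ fQ.
  by exists [::] => //=; rewrite eP eQ.
have [Q' [i [sQ' lti szQ eQ _]]] := std_tableau_delbox sQ.
have szQP : size Q = size P by rewrite -(size_map size P) sh size_map.
case D: (del P i) => [U x].
have [||||sU shU I _ _] := @ssyt_del P i (map size Q') U x sP _ _ _ _ D.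
- by case/andP: sQ' => /ssyt_shape.
- by rewrite sh eQ shape_addbox ?szQ.
- by rewrite -szQP.
- by rewrite size_map szQ.
have szU : size U = L by rewrite -(size_map size U) shU size_map szQ szQP.
have [s szs Es] := IH U Q' (ltnW ltL) sU sQ' shU szU.
by exists (x :: s); rewrite /= ?szs // Es I -eQ.
Qed.

(** Follows from [ins_ascent] for the two insertions that create the boxes [j] and [j.+1]; later
    boxes do not move them. The reversal undoes the right-to-left reading of [rs]. *)
Lemma rs_ascent L s P Q j : size s <= L -> rs L s = (P, Q) -> 0 < j < size s ->
  (row_of Q j.+1 <= row_of Q j) = (nth 0 (rev s) j.-1 <= nth 0 (rev s) j).
Proof.
elim: s P Q => [|x s IH] P Q; first by rewrite ltn0 andbF.
rewrite [size _]/= => ltL /=.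
case E: (rs L s) => [P1 Q1]; case I: (ins P1 x) => [U i] [_ <-].
have [lt1 sz1] := rs_addbox_lt ltL E I; have [sP1 sQ1 _ _ _] := rs_spec (ltnW ltL) E.
rewrite ltnS => /andP[j0]; rewrite leq_eqVlt rev_cons => /orP[/eqP ej|ltj]; last first.
  rewrite !row_of_addbox_neq ?sz1 ?ltn_eqF //; try lia.
  by rewrite !nth_rcons size_rev ltj (leq_ltn_trans (leq_pred _) ltj) (IH _ _ (ltnW ltL) E) ?j0.
rewrite ej row_of_addbox ?sz1 ?(std_tableau_mem _ sQ1) ?ltnn ?andbF //.
rewrite row_of_addbox_neq ?sz1 ?ltn_eqF //.
case: s j0 ej ltL {IH} E sQ1 => [|y s] j0 ej ltL /=; first by rewrite ej in j0.
case E0: (rs L s) => [P0 Q0]; case I0: (ins P0 y) => [V k] [eV <-] sQ1.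
have [lt0 sz0] := rs_addbox_lt (ltnW ltL) E0 I0.
have [/andP[sP0 _] sQ0 _ _ _] := rs_spec (ltnW (ltnW ltL)) E0.
rewrite row_of_addbox ?sz0 ?(std_tableau_mem _ sQ0) ?ltnn ?andbF // -eV in I *.
by rewrite (ins_ascent sP0 I0 I) rev_cons !nth_rcons !size_rcons size_rev ltnSn !ltnn !eqxx.
Qed.

(** * Schur coefficients as numbers of tableaux of given shape and content *)

Section Xeval.
Local Open Scope ring_scope.

Lemma xsumE (I : Type) (r : seq I) (P : pred I) (F : I -> xser) m :
  (\sum_(i <- r | P i) F i) m = \sum_(i <- r | P i) F i m.
Proof. exact: (big_morph (fun f : xser => f m)). Qed.

Lemma xmulrnE (f : xser) k m : (f *+ k) m = f m *+ k.
Proof. by elim: k => // k IH; rewrite !mulrS -IH. Qed.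

End Xeval.

(** Weak ascents, since equal letters behave as increasing under row insertion and standardization.
    Index [i] compares the letters [i] and [i+1] counted from 1, as in [AscT]. *)
Definition ascw (n : nat) (s : seq nat) : {set 'I_n} :=
  [set i : 'I_n | (1 <= i) && (nth 0 s i.-1 <= nth 0 s i)].

(** For a shape that is already a partition, the length condition in [col_strict] is automatic. *)
Lemma tableau_ssyt e T : sorted geq (map size T) -> tableau e T = ssyt e T.
Proof.
rewrite /tableau /ssyt sorted_map => gT; congr andb.
rewrite -[RHS]/(sorted (fun u v => (size v <= size u) && all (fun p =>
  p.1 < p.2) (zip u v)) T).
by rewrite (sorted_relI (relpre size geq)) gT.
Qed.

Section IntPart.
Variable n : nat.
Implicit Type la : intpart n.

Lemma intpartP la : [/\ sorted geq (parts la), sumn (parts la) = n & size (parts la) = n].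
Proof. by case/andP: (valP la) => ? /eqP ?; rewrite size_map size_tuple. Qed.

Lemma parts_inj : injective (@parts n).
Proof. by move=> la mu /inj_map e; apply/val_inj/val_inj/e; exact: val_inj. Qed.

Lemma parts_onto sh : size sh = n -> sorted geq sh -> sumn sh = n ->
  exists la, parts la = sh.
Proof.
move=> sz gsh ssh.
have lesh x : x \in sh -> x <= n.
  by rewrite -ssh => /path.splitPr[s1 s2]; rewrite sumn_cat /=; lia.
pose t : n.-tuple 'I_n.+1 := tcast sz [tuple of map inord (in_tuple sh)].
have et : [seq val i | i <- t] = sh.
  rewrite val_tcast /= -map_comp -[RHS]map_id; apply/eq_in_map => x /lesh le.
  by rewrite /= inordK.
have Pt : is_part n [seq val i | i <- t] by rewrite et /is_part gsh ssh eqxx.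
by exists (exist _ t Pt).
Qed.
End IntPart.

(** Common form of the fillings counted by [schur] ([e] is [leq], [M] a monomial) and of those in
    [SYT] ([e] is [ltn], [M] is [iota 1 n]), so that one membership criterion serves both. *)
Definition tableaux e la (M : seq nat) :=
  [seq T <- [seq reshape la s | s <- permutations M & size s == sumn la] | tableau e T].

Lemma tableaux_uniq e la M : uniq (tableaux e la M).
Proof.
rewrite filter_uniq // map_inj_in_uniq ?filter_uniq ?permutations_uniq //.
move=> s t; rewrite !mem_filter => /andP[/eqP es _] /andP[/eqP et _] /(congr1 flatten).
by rewrite !reshapeKr ?es ?et.
Qed.

Lemma mem_tableaux e la M T : sorted geq la ->
  (T \in tableaux e la M) = [&& map size T == la, ssyt e T & perm_eq (flatten T) M].
Proof.
move=> gla; rewrite mem_filter; apply/andP/and3P => [[tT /mapP[s]]|[/eqP eT sT pT]].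
  rewrite mem_filter mem_permutations => /andP[/eqP es ps] eT.
  have shT : map size T = la by rewrite eT [LHS]reshapeKl ?es.
  by rewrite shT eqxx -tableau_ssyt ?shT // tT eT reshapeKr ?es.
split; first by rewrite tableau_ssyt ?eT.
apply/mapP; exists (flatten T); last by rewrite -eT [RHS]flattenK.
by rewrite mem_filter mem_permutations pT andbT size_flatten /shape eT.
Qed.

Lemma schurE la m : schur la m = (size (tableaux leq la (enum_mset m)))%:R%R.
Proof.
rewrite /schur /words /tableaux size_filter count_map count_filter; congr _%:R%R.
by apply: eq_count => s /=; rewrite andbC.
Qed.

Lemma SYTE la : SYT la = tableaux ltn la (iota 1 (sumn la)).
Proof.
rewrite /SYT /tableaux; congr filter; congr map; apply/esym/all_filterP/allP => s.
by rewrite mem_permutations => /perm_size; rewrite size_iota => ->.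
Qed.

Section RobinsonSchensted.
Variable n : nat.

Lemma rs_AscT s P Q : size s = n -> rs n (rev s) = (P, Q) -> AscT n Q = ascw n s.
Proof.
move=> es E; apply/setP => i; rewrite !inE.
have [i0|] := ltnP 0 i; last by rewrite andbF.
have -> : i <= n.-1 by have := ltn_ord i; lia.
rewrite andbT -leqNgt (@rs_ascent n (rev s) P Q) ?size_rev ?es ?i0 ?ltn_ord //.
by rewrite revK andbT.
Qed.

Variable p : pred {set 'I_n}.

(** At each monomial [m], the words are sorted by the shape of their insertion tableau. [rs_inj] and
    [rs_surj] match those of shape [la] with pairs of a semistandard tableau of content [m] and a
    standard tableau; [rs_AscT] carries the condition [p] from the word to the latter. *)
Theorem robinson_schensted :
  (\sum_(la : intpart n) schur (parts la) *+ count (fun T =>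
    p (AscT n T)) (SYT (parts la))
   = words (fun s => (size s == n) && p (ascw n s)))%R.
Proof.
apply/funext => m; rewrite xsumE /words -size_filter.
set M := enum_mset m; set W := filter _ _.
pose f s := rs n (rev s).
have inW s : s \in W -> [/\ size s = n, perm_eq s M & p (ascw n s)].
  by rewrite mem_filter mem_permutations => /andP[/andP[/eqP]].
have specW s P Q : s \in W -> f s = (P, Q) ->
    [/\ ssyt leq P, std_tableau n Q, map size P = map size Q, size P = n &
      perm_eq (flatten P) M].
  move=> /inW[es ps _] /rs_spec; rewrite size_rev es => /(_ (leqnn n))[-> -> -> -> pP].
  by split=> //; rewrite (permPl pP) perm_rev.
have finj : {in W &, injective f}.
  move=> s t /inW[es _ _] /inW[et _ _] /rs_inj; rewrite !size_rev es et.
  by move/(_ erefl (leqnn n))/(congr1 rev); rewrite !revK.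
pose W_ (la : intpart n) := [seq s <- W | map size (f s).1 == parts la].
have -> : size W = \sum_(la : intpart n) size (W_ la).
  rewrite -sum1_size (eq_bigr (fun la =>
    \sum_(s <- W | map size (f s).1 == parts la) 1)%N).
    rewrite (exchange_big_dep xpredT) //=; apply: eq_big_seq => s sW.
    case E: (f s) => [P Q] /=; have [sP _ _ szP pP] := specW _ _ _ sW E.
    have [||la ela] := @parts_onto n (map size P) _ (ssyt_shape sP).
    - by rewrite size_map.
    - rewrite -[LHS](size_flatten P) (perm_size pP).
      by have [es /perm_size <- _] := inW _ sW.
    rewrite (big_pred1 la) // => mu; rewrite -ela eq_sym.
    by apply/eqP/eqP => [/parts_inj|->].
  by move=> la _; rewrite -big_filter sum1_size.
rewrite natr_sum; apply: eq_bigr => la _; rewrite xmulrnE schurE -mulrnA -/M.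
congr (_%:R)%R; rewrite -size_filter.
have [gla sla szla] := intpartP la.
rewrite SYTE sla.
set A := tableaux _ _ _; set B := filter _ _.
rewrite -(size_allpairs pair) -(size_map f (W_ la)).
apply/perm_size/uniq_perm.
- by apply: allpairs_uniq => [||[? ?] [? ?] _ _ []-> -> //]; [|apply: filter_uniq];
  exact: tableaux_uniq.
- rewrite map_inj_in_uniq ?filter_uniq ?permutations_uniq // => s t.
  by rewrite !mem_filter => /andP[_ sW] /andP[_ tW]; apply: finj; rewrite mem_filter.
move=> [P Q]; apply/allpairsP/mapP.
  case=> -[P' Q'] /= [AP BQ [-> ->]]; move: AP BQ.
  rewrite [_ \in A]mem_tableaux // [_ \in B]mem_filter mem_tableaux // =>
    /and3P[/eqP shP sP pP] /and4P[pQ /eqP shQ sQ pQ'].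
  have [|||s ss Es] := @rs_surj n n P' Q' (leqnn n) sP.
  - by rewrite /std_tableau sQ.
  - by rewrite shP.
  - by rewrite -(size_map size) shP.
  exists (rev s); last by rewrite /f revK.
  have fE : f (rev s) = (P', Q') by rewrite /f revK.
  rewrite mem_filter fE shP eqxx /= mem_filter size_rev ss eqxx mem_permutations /=.
  rewrite -(rs_AscT _ fE) ?size_rev ?ss // pQ /=.
  have [_ _ _ _ pf] := rs_spec (eq_leq ss) Es.
  by rewrite perm_rev -(permPl pf).
case=> s; rewrite mem_filter => /andP[/eqP shP sW] /esym E; exists (P, Q).
have [sP sQ sh szP pP] := specW _ _ _ sW E; have [es ps pA] := inW _ sW.
move: shP; rewrite E /= => shP; case/andP: sQ => sQ pQ.
by rewrite [_ \in A]mem_tableaux // [_ \in B]mem_filter mem_tableaux // -sh shP eqxx sP pP sQ pQ (rs_AscT es E) pA.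
Qed.
End RobinsonSchensted.

(** * Standardization *)

Section Standardization.
Variable n : nat.
Implicit Types (s t : seq nat) (v w : 'S_n).

(** The order of positions used by standardization: ties are broken from left to right. *)
Definition stdlt s (i j : nat) :=
  (nth 0 s i < nth 0 s j) || (nth 0 s i == nth 0 s j) && (i < j).

Definition standard v s := forall i j : 'I_n, (v i < v j) = stdlt s i j.

(** A permutation is thus determined by the comparisons of its values, which gives uniqueness of the
    standardization. *)
Lemma card_lt_perm v i : #|[set j | v j < v i]| = v i.
Proof.
rewrite -(card_imset _ (@perm_inj _ v)).
have -> : v @: [set j | v j < v i] = [set k : 'I_n | k < v i].
  apply/setP => k; rewrite inE; apply/imsetP/idP => [[j]|ltk];
    first by rewrite inE => ? ->.
  by exists (v^-1 k)%g; rewrite ?inE permKV.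
have le_n := ltnW (ltn_ord (v i)).
rewrite cardsE -sum1_card (big_ord_narrow le_n (F := fun=> 1)).
by rewrite sum1_card card_ord.
Qed.

Lemma standard_inj v w s : standard v s -> standard w s -> v = w.
Proof.
move=> sv sw; apply/permP => i; apply: val_inj.
rewrite -[LHS]card_lt_perm -[RHS]card_lt_perm; apply: eq_card => j.
by rewrite !inE sv sw.
Qed.

Lemma standard_exists s : exists v, standard v s.
Proof.
have tr i j k : stdlt s i j -> stdlt s j k -> stdlt s i k by rewrite /stdlt; lia.
(* The standardization sends a position to its rank for [stdlt]. *)
pose r (i : 'I_n) := #|[set j : 'I_n | stdlt s j i]|.
have rlt (i j : 'I_n) : stdlt s i j -> r i < r j.
  move=> ltij; apply/proper_card/properP; split.
    by apply/subsetP => k; rewrite !inE => /tr/(_ ltij).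
  by exists i; rewrite !inE // /stdlt; lia.
have rE (i j : 'I_n) : (r i < r j) = stdlt s i j.
  apply/idP/idP => [lt|]; last exact: rlt.
  have [//|nij] := boolP (stdlt s i j).
  have [eij|ne] := eqVneq i j; first by rewrite eij ltnn in lt.
  suff /rlt : stdlt s j i by lia.
  by move: nij ne; rewrite -(inj_eq val_inj) /stdlt /=; lia.
have rn i : r i < n.
  rewrite -[X in _ < X]card_ord -cardsT; apply/proper_card/properP; split=> //.
  by exists i; rewrite !inE // /stdlt; lia.
have rinj : injective (fun i => Ordinal (rn i)).
  move=> i j /(congr1 val) /= e; apply/val_inj => /=; move: (rE i j) (rE j i).
  by rewrite e ltnn /stdlt; lia.
by exists (perm rinj) => i j; rewrite !permE rE.
Qed.

Lemma ord_predE (i : 'I_n) : 0 < i -> ord_pred i = i.-1 :> nat.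
Proof.
move=> i0 /=; have -> : (i + n).-1 = i.-1 + n by lia.
by rewrite modnDr modn_small // (leq_ltn_trans (leq_pred i)).
Qed.

Lemma standard_Asc v s : standard v s -> Asc v = ascw n s.
Proof.
move=> sv; apply/setP => i; rewrite !inE.
have [i0|] := ltnP 0 i; last by rewrite andbF.
have -> : i <= n.-1 by have := ltn_ord i; lia.
by rewrite andbT sv /stdlt ord_predE //; lia.
Qed.

Definition strict_at (A : {set 'I_n}) t := [forall j in A, nth 0 t j.-1 < nth 0 t j].

(** For sorted [t], strict at the descents of [v^-1], this is the rearrangement of [t] whose
    standardization is [v]. *)
Definition perm_word t v := [seq nth 0 t (v i) | i <- enum 'I_n].

Lemma nth_perm_word t v (i : 'I_n) : nth 0 (perm_word t v) i = nth 0 t (v i).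
Proof. by rewrite (nth_map i) ?size_enum_ord // nth_ord_enum. Qed.

Lemma perm_perm_word t v : size t = n -> perm_eq (perm_word t v) t.
Proof.
move=> st; rewrite /perm_word -[X in perm_eq _ X](take_size t) -(map_nth_iota0 0 (leqnn _)) st.
rewrite -val_enum_ord -[X in perm_eq _ X]map_comp.
rewrite -[X in perm_eq X _]/(map ((nth 0 t \o val) \o v) _) map_comp; apply: perm_map.
apply: uniq_perm; rewrite ?enum_uniq ?(map_inj_uniq perm_inj) ?enum_uniq // => i.
by rewrite !mem_enum; apply/mapP; exists (v^-1 i)%g; rewrite ?mem_enum // permKV.
Qed.

Lemma standard_perm_word t v : size t = n -> sorted leq t -> strict_at (Des (v^-1)%g) t ->
  standard v (perm_word t v).
Proof.
move=> st lt /forallP sD.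
have tle a b : a <= b -> b < n -> nth 0 t a <= nth 0 t b.
  by move=> leab ltb; apply: (sorted_leq_nth leq_trans leqnn) => //; rewrite inE st; lia.
(* On a block of equal letters [t] has no strict step, so [v^-1] has no descent there and increases
   along the block. *)
have eqlt (b : 'I_n) : forall a : 'I_n, a < b -> nth 0 t a = nth 0 t b ->
  (v^-1)%g a < (v^-1)%g b.
  case: b => b ltb; elim: b ltb => // b IH ltb a /=; rewrite ltnS => leab eab.
  have ltb' := ltnW ltb.
  have ebb : nth 0 t b = nth 0 t b.+1.
    by have := tle a b leab ltb'; have := tle b b.+1 (leqnSn b) ltb; lia.
  have := sD (Ordinal ltb); rewrite inE /= ebb ltnn implybF -leqNgt.
  have -> : ord_pred (Ordinal ltb) = Ordinal ltb'.
    by apply: val_inj; exact: (@ord_predE (Ordinal ltb) isT).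
  have ne : (v^-1)%g (Ordinal ltb') != (v^-1)%g (Ordinal ltb) :> nat.
    by rewrite (inj_eq val_inj) (inj_eq perm_inj) -(inj_eq val_inj) /= neq_ltn ltnSn.
  rewrite leq_eqVlt (negPf ne) /= => ltS.
  have [eb|nb] := eqVneq (a : nat) b.
    by rewrite (_ : a = Ordinal ltb') //; apply: val_inj.
  apply: ltn_trans ltS; apply: IH => /=; [lia | by rewrite eab].
have lt_std (i j : 'I_n) : v i < v j -> stdlt (perm_word t v) i j.
  move=> ltij; rewrite /stdlt !nth_perm_word.
  have := tle _ _ (ltnW ltij) (ltn_ord _); rewrite leq_eqVlt => /orP[/eqP e|-> //].
  by have := eqlt _ _ ltij e; rewrite !permK e eqxx => ->; rewrite orbT.
move=> i j; apply/idP/idP => [|ltij]; first exact: lt_std.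
rewrite ltnNge leq_eqVlt; apply/negP => /orP[|/lt_std]; last by move: ltij;
  rewrite /stdlt; lia.
rewrite (inj_eq val_inj) (inj_eq perm_inj) => /eqP e.
by move: ltij; rewrite e /stdlt; lia.
Qed.

(** Reading [s] in the order [v^-1] sorts it, so it gives [t]. Where [v^-1] descends, two
    consecutive ranks sit at positions in decreasing order, and the tie-breaking rule forces their
    letters to differ. *)
Lemma standard_strict v s t : size t = n -> perm_eq s t -> sorted leq t -> standard v s ->
  perm_word t v = s /\ strict_at (Des (v^-1)%g) t.
Proof.
move=> st pst lt sv; have ss : size s = n by rewrite (perm_size pst).
have et : perm_word s (v^-1)%g = t.
  apply: (sorted_eq leq_trans anti_leq) => //; last first.
    by apply: perm_trans pst; exact: perm_perm_word.
  apply/(sortedP 0) => a; rewrite size_map size_enum_ord => lta.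
  have := nth_perm_word s (v^-1)%g (Ordinal lta); rewrite /= => ->.
  have := nth_perm_word s (v^-1)%g (Ordinal (ltnW lta)); rewrite /= => ->.
  have := sv ((v^-1)%g (Ordinal (ltnW lta))) ((v^-1)%g (Ordinal lta)).
  by rewrite !permKV /= ltnSn /stdlt; lia.
have nt (i : 'I_n) : nth 0 t i = nth 0 s ((v^-1)%g i) by rewrite -et nth_perm_word.
split.
  apply: (@eq_from_nth _ 0); first by rewrite size_map size_enum_ord ss.
  move=> i; rewrite size_map size_enum_ord => lti.
  by have := nth_perm_word t v (Ordinal lti); rewrite /= => ->; rewrite nt permK.
apply/forallP => j; apply/implyP; rewrite inE => /andP[j0 ltj].
have ep := ord_predE j0.
have := nt (ord_pred j); rewrite ep => ->; rewrite nt.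
have := sv ((v^-1)%g (ord_pred j)) ((v^-1)%g j); rewrite !permKV ep /stdlt; lia.
Qed.

(** At a monomial [m] with sorted word [t], [Fqsym (Des w)] has coefficient 1 if [t] has size [n]
    and is strict at [Des w], and 0 otherwise. With [v] the inverse of [w], [perm_word t] maps the
    contributing [v] bijectively onto the words on the right; standardization is the inverse map. *)
Theorem standardization (p : pred {set 'I_n}) :
  (\sum_(w : 'S_n | p (Asc (w^-1)%g)) Fqsym (Des w)
   = words (fun s => (size s == n) && p (ascw n s)))%R.
Proof.
apply/funext => m; rewrite xsumE /words -size_filter.
set M := enum_mset m; set W := filter _ _.
pose t := sort leq M.
have pt : perm_eq t M by apply/permPl/perm_sort.
have lt : sorted leq t by apply: sort_sorted; exact: leq_total.
have FE w : Fqsym (Des w) m = ((size M == n) && strict_at (Des w) t)%:R%R.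
  rewrite /Fqsym /words -/M; congr _%:R%R.
  transitivity (count (fun s =>
    (s == t) && ((size M == n) && strict_at (Des w) t)) (permutations M)).
    apply: eq_in_count => s; rewrite mem_permutations => ps.
    rewrite (perm_size ps); case: (size M == n) => //=; last by rewrite andbF.
    have [->|ne] := eqVneq s t; first by rewrite lt.
    suff /negPf-> : ~~ sorted leq s by [].
    apply: contra ne => ls; apply/eqP/(sorted_eq leq_trans anti_leq) => //.
    by rewrite (permPl ps) perm_sym.
  case: (_ && _).
    under eq_count do rewrite andbT.
    by rewrite (count_uniq_mem _ (permutations_uniq _)) mem_permutations pt.
  by under eq_count do rewrite andbF; rewrite count_pred0.
have [sM|nM] := eqVneq (size M) n; last first.
  rewrite big1 => [|w _]; last by rewrite FE (negPf nM).
  have -> // : W = [::].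
  apply/eqP; rewrite -[_ == _]negbK -has_filter; apply/hasPn => s.
  by rewrite mem_permutations => /perm_size->; rewrite (negPf nM).
have st : size t = n by rewrite (perm_size pt).
pose C := [seq v <- index_enum 'S_n | p (Asc v) && strict_at (Des (v^-1)%g) t].
have -> : size W = size C.
  rewrite -(size_map (perm_word t)); apply/perm_size/uniq_perm.
  - by rewrite filter_uniq ?permutations_uniq.
  - rewrite map_inj_in_uniq ?filter_uniq ?index_enum_uniq // => v w.
    rewrite !mem_filter => /andP[/andP[_ sv] _] /andP[/andP[_ sw] _] e.
    have := standard_perm_word st lt sw; rewrite -e.
    by apply: standard_inj; exact: standard_perm_word.
  move=> s; rewrite mem_filter mem_permutations;
    apply/andP/mapP => [[/andP[_ ps] psM]|[v]].
    have pst : perm_eq s t by rewrite (permPl psM) perm_sym.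
    have [v sv] := standard_exists s.
    have [es sD] := standard_strict st pst lt sv.
    by exists v => //; rewrite mem_filter mem_index_enum sD (standard_Asc sv) ps.
  rewrite mem_filter => /andP[/andP[pv sD] _] ->.
  rewrite size_map size_enum_ord eqxx -(standard_Asc (standard_perm_word st lt sD)) pv.
  by split=> //; apply: perm_trans pt; exact: perm_perm_word.
rewrite (reindex_inj invg_inj) /= size_filter -sum1_count natr_sum big_mkcondr /=.
apply: eq_big => [v|v _]; first by rewrite invgK.
by rewrite FE sM eqxx; case: strict_at.
Qed.
End Standardization.

(** * Weights of words *)

Local Open Scope mset_scope.
Local Open Scope ring_scope.

Definition word_ascents (s : seq nat) : seq bool :=
  if s is x :: s' then pairmap leq x s' else [::].

(* Weights of the words counted by xi (first component) and by gamma (second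
   component), as functions of the list of ascents. *)
Fixpoint run_weight (a : seq bool) : {poly int} * {poly int} :=
  if a is b :: a' then
    let: (c, c') := run_weight a' in
    (if b then 0 else c', if b then 'X * c else (1 + 'X) * c')
  else (0, 'X).

Definition xi_weight (s : seq nat) : {poly int} :=
  if s is [::] then 1 else (run_weight (word_ascents s)).1.

Definition gamma_weight (s : seq nat) : {poly int} :=
  if s is [::] then 1 else (run_weight (word_ascents s)).2.

(** The weight of the word [s] in [E(x; uz)] times the series of xi: [s] is cut after a strictly
    decreasing prefix. *)
Definition prefix_sum (u : {poly int}) (s : seq nat) : {poly int} :=
  \sum_(i < (size s).+1) (sorted gtn (take i s))%:R * u ^+ i * xi_weight (drop i s).

(** The prefix is empty or contains [a]; in the latter case it can extend past [a] only over a
    descent. *)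
Lemma prefix_sum_cons2 u a b s : prefix_sum u [:: a, b & s] =
  xi_weight [:: a, b & s] +
  u * (if (b < a)%N then prefix_sum u (b :: s) else xi_weight (b :: s)).
Proof.
rewrite /prefix_sum big_ord_recl /= !mul1r; congr (_ + _).
rewrite big_ord_recl /= expr1 mul1r.
case: ifP => ba.
  rewrite [X in _ = u * X]big_ord_recl /= !mul1r mulrDr; congr (_ + _).
  rewrite mulr_sumr; apply: eq_bigr => i _; rewrite /bump /= !add1n add0n /=.
  by rewrite (exprS u i.+1); ring.
by rewrite big1 ?addr0 // => i _; rewrite !mul0r.
Qed.

(** With [c] and [c'] the two weights of the tail, the recursion gives [0 + 'X * c] at an ascent and
    [c' + 'X * c'] at a descent, as in [run_weight]. *)
Lemma prefix_sumX s : prefix_sum 'X s = gamma_weight s.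
Proof.
elim: s => [|a s IH]; first by rewrite /prefix_sum big_ord1 /= !mul1r.
case: s IH => [|b s] IH.
  by rewrite /prefix_sum !big_ord_recl big_ord0 /= expr0 !expr1 !mul1r mulr1 addr0 add0r.
rewrite prefix_sum_cons2 IH /= ltnNge; case: run_weight => c c'.
by case: (a <= b)%N => /=; ring.
Qed.

(** Same recursion, with ['X * c' + c'] at a descent. The empty word gives ['X] instead of 1, the
    source of the numerator [1 - 'X]. *)
Lemma prefix_sum1 s : 'X * prefix_sum 1 s = if s is [::] then 'X else gamma_weight s.
Proof.
elim: s => [|a s IH]; first by rewrite /prefix_sum big_ord1 /= !mul1r mulr1.
case: s IH => [|b s] IH.
  by rewrite /prefix_sum !big_ord_recl big_ord0 /= !expr1n !mul1r addr0 add0r mulr1.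
rewrite prefix_sum_cons2 mulrDr mul1r.
have -> : 'X * (if (b < a)%N then prefix_sum 1 (b :: s) else xi_weight (b :: s)) =
  if (b < a)%N then gamma_weight (b :: s) else 'X * xi_weight (b :: s) by case: ifP.
rewrite /= ltnNge; case: run_weight => c c'.
by case: (a <= b)%N => /=; ring.
Qed.

(** * Closed form of the weights and stable ascent sets *)

Definition nand (b c : bool) := ~~ (b && c).

(** Every ascent starts a new decreasing run, so [k] ascents give [k.+1] runs, each with one factor
    ['X]. The final sentinel [true] forces the last run to have length at least 2, and the initial
    one of [path] does so for the first run. The inequalities keep the truncated subtractions in the
    exponents exact. *)
Lemma run_weightE a : let k := count id a in let n := (size a).+1 in
  [/\ (run_weight a).1 = (if path nand true (rcons a true)
         then 'X ^+ k.+1 * (1 + 'X) ^+ (n - 2 * k - 2) else 0),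
      (run_weight a).2 = (if sorted nand (rcons a true)
         then 'X ^+ k.+1 * (1 + 'X) ^+ (n - 1 - 2 * k) else 0),
      path nand true (rcons a true) -> (2 * k < size a)%N &
      sorted nand (rcons a true) -> (2 * k <= size a)%N].
Proof.
elim: a => [|b a IH]; first by rewrite /= mulr1.
move: IH => /=; case: run_weight => c c' /= [-> -> lt1 lt2].
have path_false l : path nand false l = sorted nand l by case: l.
case: b => /=.
  rewrite add1n; split=> //; last by move/lt1; lia.
  case: ifP => [/lt1 lt|]; last by rewrite mulr0.
  by rewrite mulrA -exprS; congr (_ * _ ^+ _); lia.
rewrite add0n path_false; split=> //; try by move/lt2; lia.
  by case: ifP => // /lt2 lt; congr (_ * _ ^+ _); lia.
case: ifP => [/lt2 lt|]; last by rewrite mulr0.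
by rewrite mulrCA -exprS; congr (_ * _ ^+ _); lia.
Qed.

Section AscentSet.
Variables (n : nat) (s : seq nat).
Hypothesis size_s : size s = n.
Hypothesis n_gt0 : (0 < n)%N.
Let a := word_ascents s.

Lemma size_word_ascents : size (false :: a) = n.
Proof. by rewrite /= /a; case: s size_s n_gt0 => [<-//|x s' <- _];
  rewrite size_pairmap. Qed.

(** The extra [false] fills index 0 of ['I_n], which is never an ascent. *)
Lemma ascwE : ascw n s = [set i : 'I_n | nth false (false :: a) i].
Proof.
apply/setP => -[i lti]; rewrite !inE /= /a.
case: s size_s => [e|x s' e]; first by rewrite -e in lti.
by case: i lti => //= i; rewrite -e /= ltnS => lti; rewrite (nth_pairmap 0).
Qed.

Lemma card_ascw : #|ascw n s| = count id a.
Proof.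
rewrite ascwE cardsE -sum1_card -[RHS]/(count id (false :: a)) -sum1_count.
by rewrite (big_nth false) size_word_ascents big_mkord.
Qed.

Lemma Stab_ascwP lo hi :
  reflect ((forall i, (i < n)%N -> nth false (false :: a) i -> (lo <= i <= hi)%N) /\
           (forall i, (i.+1 < n)%N -> ~~ (nth false (false :: a) i && nth false a i)))
    (ascw n s \in Stab (itv n lo hi)).
Proof.
rewrite ascwE inE; apply: (iffP andP) => [[/subsetP sub /'forall_implyP nc]|[sub nc]];
  split.
- by move=> i lti bi; have := sub (Ordinal lti); rewrite !inE /=; apply.
- move=> i lti; apply/negP => /andP[bi bj].
  have := nc (Ordinal (ltnW lti));
    rewrite inE => /(_ bi)/'forall_implyP/(_ (Ordinal lti)).
  by rewrite inE /= eqxx => /(_ bj).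
- by apply/subsetP => i; rewrite !inE => bi; exact: sub.
apply/'forall_implyP => i; rewrite inE => bi; apply/'forall_implyP => j;
  rewrite inE => bj.
apply/eqP => ej; have := nc i; rewrite -ej ltn_ord => /(_ isT).
by rewrite bi; move: bj; rewrite ej /= => ->.
Qed.

(** The upper bound [n - 2] excludes an ascent at [n-1], which is what the sentinel [true] at the
    end does. *)
Lemma Stab_ascw_gamma :
  (ascw n s \in Stab (itv n 1 (n - 2))) = sorted nand (rcons a true).
Proof.
have sa : n = (size a).+1 by rewrite -size_word_ascents.
apply/Stab_ascwP/(sortedP false) => [[sub nc] i|H].
  rewrite size_rcons !nth_rcons ltnS => lti; rewrite lti /nand; apply/negP => /andP[bi].
  have := sub i.+1; rewrite /= sa ltnS => /(_ lti bi) lei.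
  have lti' : (i.+1 < size a)%N by lia.
  rewrite lti' => bi'; have := nc i.+1; rewrite sa ltnS /= => /(_ lti').
  by rewrite bi bi'.
split=> [[|i]//|[|i] //]; rewrite sa ltnS => lti /=.
  move=> bi; rewrite leqNgt; apply/negP => ge.
  have ei : i.+1 = size a by lia.
  by have := H i; rewrite size_rcons !nth_rcons lti bi ei ltnn eqxx /nand /= =>
    /(_ (ltnSn _)).
have := H i; rewrite size_rcons !nth_rcons lti (ltnW lti) ltnS /nand; apply; exact: ltnW.
Qed.

(** The lower bound 2 additionally excludes an ascent at 1, hence the sentinel [true] in front. *)
Lemma Stab_ascw_xi : (1 < n)%N ->
  (ascw n s \in Stab (itv n 2 (n - 2))) = path nand true (rcons a true).
Proof.
move=> n_gt1.
have sa : n = (size a).+1 by rewrite -size_word_ascents.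
have -> : path nand true (rcons a true) = ~~ nth false a 0 && sorted nand (rcons a true).
  by case: (a) sa => [|b a'] /=; [lia | rewrite /nand].
rewrite -Stab_ascw_gamma; apply/Stab_ascwP/andP => [[sub nc]|[b0 /Stab_ascwP[sub nc]]].
  split; first by apply/negP => /(sub 1%N n_gt1).
  by apply/Stab_ascwP; split=> // i lti /(sub i lti); lia.
split=> // i lti bi; have := sub i lti bi.
case: i lti bi => [|[|i]] //= lti bi; first by rewrite bi in b0.
Qed.
End AscentSet.

Lemma xi_weightE n s : (1 < n)%N -> size s = n -> let k := #|ascw n s| in
  (xi_weight s = if ascw n s \in Stab (itv n 2 (n - 2))
    then 'X ^+ k.+1 * (1 + 'X) ^+ (n - 2 * k - 2) else 0) /\
  (ascw n s \in Stab (itv n 2 (n - 2)) -> (k < ((n - 2) %/ 2).+1)%N).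
Proof.
move=> n1 ss; have n0 := ltnW n1; rewrite /= (Stab_ascw_xi ss n0 n1) (card_ascw ss n0).
have sa : (size (word_ascents s)).+1 = n := size_word_ascents ss n0.
have [E _ H _] := run_weightE (word_ascents s); rewrite -{1}sa.
split; last by move/H; rewrite ltnS leq_divRL //; lia.
case: s ss sa E {H} => [|x s] ss sa E; first by rewrite -ss in n0.
by rewrite -[LHS]/((run_weight (word_ascents (x :: s))).1) E sa.
Qed.

Lemma gamma_weightE n s : (0 < n)%N -> size s = n -> let k := #|ascw n s| in
  (gamma_weight s = if ascw n s \in Stab (itv n 1 (n - 2))
    then 'X ^+ k.+1 * (1 + 'X) ^+ (n - 1 - 2 * k) else 0) /\
  (ascw n s \in Stab (itv n 1 (n - 2)) -> (k < ((n - 1) %/ 2).+1)%N).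
Proof.
move=> n0 ss; rewrite /= (Stab_ascw_gamma ss n0) (card_ascw ss n0).
have sa : (size (word_ascents s)).+1 = n := size_word_ascents ss n0.
have [_ E _ H] := run_weightE (word_ascents s); rewrite -{1}sa.
split; last by move/H; rewrite ltnS leq_divRL //; lia.
case: s ss sa E {H} => [|x s] ss sa E; first by rewrite -ss in n0.
by rewrite -[LHS]/((run_weight (word_ascents (x :: s))).2) E sa.
Qed.

(** * Weighted generating functions of words *)

(** [g] is the sum of [f s] times the monomial of [s] over all words [s]; identities of series
    thereby reduce to identities between weights of single words. *)
Definition word_gf (g : {poly xser}) (f : seq nat -> {poly int}) : Prop :=
  forall j m, g`_j m = \sum_(s <- permutations (enum_mset m)) (f s)`_j.

Lemma word_gf_uniq g g' f f' : word_gf g f -> word_gf g' f' -> f =1 f' -> g = g'.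
Proof.
move=> G G' ff'; apply/polyP => j; apply/funext => m.
by rewrite G G'; apply: eq_bigr => s _; rewrite ff'.
Qed.

Lemma eq_word_gf g f f' : f =1 f' -> word_gf g f -> word_gf g f'.
Proof. by move=> ff' G j m; rewrite G; apply: eq_bigr => s _; rewrite ff'. Qed.

Lemma word_gf_sum (I : Type) (r : seq I) (g : I -> {poly xser}) f :
  (forall i, word_gf (g i) (f i)) ->
  word_gf (\sum_(i <- r) g i) (fun s => \sum_(i <- r) f i s).
Proof.
move=> G j m; rewrite coef_sum xsumE (eq_bigr _ (fun i _ => G i j m)) exchange_big /=.
by apply: eq_bigr => s _; rewrite coef_sum.
Qed.

Lemma word_gf_words P : word_gf (words P)%:P (fun s => (P s)%:R).
Proof.
move=> j m; transitivity (if j == 0%N then words P m else 0); first by rewrite coefC;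
  case: eqP.
rewrite /words -sum1_count natr_sum; case: (eqVneq j 0%N) => [->|nj].
  rewrite big_mkcond /=; apply: eq_bigr => s _.
  by case: (P s); rewrite ?coef1 ?coef0.
by rewrite big1 // => s _; rewrite -[_%:R]/(_%:R) -polyC_natr coefC (negPf nj).
Qed.

Lemma word_gfMX g f : word_gf g f -> word_gf (g * 'X) (fun s => f s * 'X).
Proof.
move=> G [|j] m; first by rewrite coefMX big1 // => s _; rewrite coefMX.
by rewrite coefMX /= G; apply: eq_bigr => s _; rewrite coefMX.
Qed.

Lemma word_gfD g f g' f' : word_gf g f -> word_gf g' f' ->
  word_gf (g + g') (fun s => f s + f' s).
Proof.
move=> G G' j m; transitivity (g`_j m + g'`_j m); first by rewrite coefD.
by rewrite G G' -big_split; apply: eq_bigr => s _; rewrite coefD.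
Qed.

Lemma word_gfMXn g f k : word_gf g f -> word_gf (g * 'X^k) (fun s => f s * 'X^k).
Proof.
move=> G; elim: k => [|k IH]; first by rewrite mulr1; apply: eq_word_gf G => s;
  rewrite mulr1.
rewrite exprSr mulrA; apply: eq_word_gf (word_gfMX IH) => s.
by rewrite exprSr mulrA.
Qed.

Lemma word_gfM1Xn g f k : word_gf g f ->
  word_gf (g * (1 + 'X) ^+ k) (fun s => f s * (1 + 'X) ^+ k).
Proof.
move=> G; elim: k => [|k IH]; first by rewrite mulr1; apply: eq_word_gf G => s;
  rewrite mulr1.
rewrite exprSr mulrA mulrDr mulr1; apply: eq_word_gf (word_gfD IH (word_gfMX IH)) => s.
by rewrite exprSr; ring.
Qed.

(** * Products of series and cuts of words *)

Lemma seq_mset_cat (u v : seq nat) : seq_mset (u ++ v) = (seq_mset u `+` seq_mset v)%mset.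
Proof. by apply/msetP => x; rewrite msetE2 !mset_seqE count_cat. Qed.

Lemma mem_permutations_mset (u : seq nat) (a : {mset nat}) :
  (u \in permutations (enum_mset a)) = (seq_mset u == a).
Proof.
rewrite mem_permutations; apply/idP/eqP => [/eq_seq_msetP->|<-]; first exact: seq_mset_id.
by apply/eq_seq_msetP; rewrite seq_mset_id.
Qed.

(** The submultiset [a] in a product of series is the content of the first [i] letters; with the
    prefix length fixed, each word is cut in exactly one way. *)
Lemma sum_split_words (i : nat) (m : {mset nat}) (F : seq nat -> seq nat -> int) :
  \sum_(a <- submsets m) \sum_(u <- permutations (enum_mset a) | size u == i)
     \sum_(v <- permutations (enum_mset (m `\` a)%mset)) F u v =
  \sum_(s <- permutations (enum_mset m) | (i <= size s)%N) F (take i s) (drop i s).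
Proof.
pose P (a : {mset nat}) (s : seq nat) := (i <= size s)%N && (seq_mset (take i s) == a).
transitivity (\sum_(a <- submsets m) \sum_(s <- permutations (enum_mset m) | P a s)
    F (take i s) (drop i s)); last first.
  rewrite (exchange_big_dep (fun s => (i <= size s)%N)) /=; last by move=> a s _ /andP[].
  rewrite big_seq_cond [RHS]big_seq_cond; apply: eq_bigr => s /andP[].
  rewrite mem_permutations_mset => /eqP sm lei.
  rewrite (eq_bigl (fun a => a == seq_mset (take i s))); last first.
    by move=> a; rewrite /P lei eq_sym.
  rewrite (big_rem (seq_mset (take i s))) /=; last first.
    rewrite mem_submsets -sm -{2}(cat_take_drop i s) seq_mset_cat.
    by apply/msubsetP => x; rewrite msetE2 leq_addr.
  rewrite eqxx big_seq_cond big_pred0 ?addr0 // => a.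
  by case: eqP => [->|]; rewrite ?andbF // mem_rem_uniqF ?submsets_uniq.
apply: eq_big_seq => a; rewrite mem_submsets => le_am.
rewrite -[RHS]big_filter.
have /(perm_big _) -> : perm_eq [seq s <- permutations (enum_mset m) | P a s]
    [seq u ++ v | u <- [seq u <- permutations (enum_mset a) | size u == i],
                  v <- permutations (enum_mset (m `\` a)%mset)].
  apply: uniq_perm.
  - by rewrite filter_uniq ?permutations_uniq.
  - apply: allpairs_uniq; rewrite ?filter_uniq ?permutations_uniq //.
    move=> [u v] [u' v'] /allpairsP[[x y] /= [+ _ [-> _]]] /allpairsP[[x' y'] /= [+ _ [-> _]]].
    rewrite !mem_filter => /andP[/eqP su _] /andP[/eqP su' _] /eqP.
    by rewrite eqseq_cat ?su // => /andP[/eqP-> /eqP->].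
  move=> s; rewrite mem_filter mem_permutations_mset; apply/andP/allpairsP.
    move=> [/andP[lei /eqP sa] /eqP sm]; exists (take i s, drop i s) => /=.
    rewrite cat_take_drop mem_filter size_takel // eqxx !mem_permutations_mset sa eqxx.
    by rewrite -sm -{2}(cat_take_drop i s) seq_mset_cat sa msetDKB.
  case=> -[u v] /= []; rewrite mem_filter !mem_permutations_mset =>
    /andP[/eqP su /eqP ua] /eqP va ->.
  rewrite seq_mset_cat ua va msetBDKC // eqxx /P size_cat su leq_addr; split=> //.
  by rewrite take_size_cat // ua eqxx.
rewrite big_allpairs_dep big_filter; apply: eq_bigr => u /eqP su.
by apply: eq_bigr => v _; rewrite take_size_cat ?drop_size_cat.
Qed.

Lemma word_gf_wordsM i P g f : word_gf g f ->
  word_gf ((words (fun s => (size s == i) && P s))%:P * g)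
    (fun s => if (i <= size s)%N then (P (take i s))%:R * f (drop i s) else 0).
Proof.
move=> G j m; rewrite coefCM.
transitivity (\sum_(a <- submsets m) \sum_(u <- permutations (enum_mset a) | size u == i)
     \sum_(v <- permutations (enum_mset (m `\` a)%mset)) (P u)%:R * (f v)`_j).
  apply: eq_bigr => a _; rewrite G /words -sum1_count natr_sum mulr_suml.
  rewrite big_mkcondr /=; apply: eq_bigr => u su.
  by rewrite -mulr_sumr; case: (P u); rewrite ?mul1r ?mul0r.
rewrite (sum_split_words i m (fun u v => (P u)%:R * (f v)`_j)) big_mkcond /=.
apply: eq_bigr => s _; case: ifP => _; last by rewrite coef0.
by case: (P _); rewrite ?mul1r ?mul0r ?coef0.
Qed.

(** Reversal permutes the rearrangements of a monomial. It lets [elem] be read as decreasing words,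
    the form of the prefixes in [prefix_sum]. *)
Lemma words_rev P : words P = words (fun s => P (rev s)).
Proof.
apply/funext => m; rewrite /words; congr _%:R.
rewrite -(count_map rev P); apply/seq.permP; apply: uniq_perm.
- exact: permutations_uniq.
- by rewrite (map_inj_uniq (can_inj revK)) permutations_uniq.
move=> s; apply/idP/mapP => [ps|[t pt ->]].
  by exists (rev s); rewrite ?revK // mem_permutations perm_rev -mem_permutations.
by rewrite mem_permutations perm_rev -mem_permutations.
Qed.

Lemma elemE n : elem n = words (fun s => (size s == n) && sorted gtn s).
Proof.
rewrite /elem words_rev; apply/funext => m; congr _%:R; apply: eq_count => s /=.
by rewrite size_rev rev_sorted.
Qed.

(** * The two series *)

Lemma xi_words n k : xi n k = words (fun s => (size s == n) &&
  ((ascw n s \in Stab (itv n 2 (n - 2))) && (#|ascw n s| == k))).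
Proof.
exact: (robinson_schensted (fun A => (A \in Stab (itv n 2 (n - 2))) && (#|A| == k))).
Qed.

Lemma gamma_words n k : gamma n k = words (fun s => (size s == n) &&
  ((ascw n s \in Stab (itv n 1 (n - 2))) && (#|ascw n s| == k))).
Proof.
exact: (robinson_schensted (fun A => (A \in Stab (itv n 1 (n - 2))) && (#|A| == k))).
Qed.

Lemma elem0 : elem 0 = 1.
Proof.
apply/funext => m; rewrite -[RHS]/((m == mset0)%:R) /elem /words; congr _%:R.
have [->|nm] := eqVneq m mset0; first by rewrite enum_mset0.
apply/eqP; rewrite -leqn0 leqNgt -has_count; apply/hasPn => s.
rewrite mem_permutations_mset => /eqP sm; case: s sm => //= sm.
by case/eqP: nm; rewrite -sm; apply/msetP => x; rewrite mset_seqE mset0E.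
Qed.

Lemma word_gf1 : word_gf 1 (fun s => (size s == 0%N)%:R).
Proof.
rewrite -polyC1 -elem0; apply: eq_word_gf (word_gf_words _) => s.
by case: s.
Qed.

(** For a single word, this collapses the sum over [k] to its number of ascents, which the
    hypothesis places inside the summation range. *)
Lemma sum_select (R : nzSemiRingType) N (k : nat) (b : bool) (F : nat -> R) : (b ->
  (k < N)%N) ->
  \sum_(i < N) (b && (k == i))%:R * F i = if b then F k else 0.
Proof.
case: b => [/(_ isT) ltk|_]; last by rewrite big1 // => i _; rewrite mul0r.
rewrite (bigD1 (Ordinal ltk)) //= eqxx mul1r big1 ?addr0 // => i ne.
case: (eqVneq k i) => [ek|_]; last by rewrite mul0r.
by case/eqP: ne; apply/ord_inj/esym.
Qed.

Definition xi_series : zser {poly xser} :=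
  1 + zsum_from 2 (fun n => \sum_(k < ((n - 2) %/ 2).+1)
        (xi n k)%:P * 'X ^+ k.+1 * (1 + 'X) ^+ (n - 2 * k - 2)).

Definition gamma_series : zser {poly xser} :=
  1 + zsum_from 1 (fun n => \sum_(k < ((n - 1) %/ 2).+1)
        (gamma n k)%:P * 'X ^+ k.+1 * (1 + 'X) ^+ (n - 1 - 2 * k)).

Lemma word_gf_xi n : word_gf (xi_series n) (fun s => (size s == n)%:R * xi_weight s).
Proof.
case: n => [|[|n]].
- rewrite [xi_series 0]addr0; apply: eq_word_gf word_gf1 => -[|x s];
  first by rewrite mulr1.
  by rewrite mul0r.
(* There is no term of degree 1, and one-letter words have weight 0. *)
- rewrite [xi_series 1]addr0 => j m; rewrite coef0 big1 // => s _.
  by case: s => [|x [|y s]]; rewrite /= ?mul0r ?mulr0 coef0.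
set N := n.+2; have -> : xi_series N = \sum_(k < ((N - 2) %/ 2).+1)
        (xi N k)%:P * 'X ^+ k.+1 * (1 + 'X) ^+ (N - 2 * k - 2) by exact: add0r.
have G (k : 'I_((N - 2) %/ 2).+1) := word_gfM1Xn (N - 2 * k - 2)
   (word_gfMXn k.+1 (word_gf_words (fun s => (size s == N) &&
  ((ascw N s \in Stab (itv N 2 (N - 2))) && (#|ascw N s| == k))))).
under eq_bigr do rewrite xi_words.
apply: eq_word_gf (word_gf_sum _ G) => s.
have [ss|ns] := eqVneq (size s) N; last first.
  by rewrite mul0r big1 // => k _; rewrite !mul0r.
have [-> /sum_select] := @xi_weightE N s isT ss.
move/(_ _ (fun k => 'X^(k.+1) * (1 + 'X) ^+ (N - 2 * k - 2))) => <-.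
by rewrite mul1r; apply: eq_bigr => k _; rewrite mulrA.
Qed.

Lemma word_gf_gamma n : word_gf (gamma_series n) (fun s =>
  (size s == n)%:R * gamma_weight s).
Proof.
case: n => [|n].
  rewrite [gamma_series 0]addr0; apply: eq_word_gf word_gf1 => -[|x s];
    first by rewrite mulr1.
  by rewrite mul0r.
set N := n.+1; have -> : gamma_series N = \sum_(k < ((N - 1) %/ 2).+1)
        (gamma N k)%:P * 'X ^+ k.+1 * (1 + 'X) ^+ (N - 1 - 2 * k) by exact: add0r.
have G (k : 'I_((N - 1) %/ 2).+1) := word_gfM1Xn (N - 1 - 2 * k)
   (word_gfMXn k.+1 (word_gf_words (fun s => (size s == N) &&
  ((ascw N s \in Stab (itv N 1 (N - 2))) && (#|ascw N s| == k))))).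
under eq_bigr do rewrite gamma_words.
apply: eq_word_gf (word_gf_sum _ G) => s.
have [ss|ns] := eqVneq (size s) N; last first.
  by rewrite mul0r big1 // => k _; rewrite !mul0r.
have [-> /sum_select] := @gamma_weightE N s isT ss.
move/(_ _ (fun k => 'X^(k.+1) * (1 + 'X) ^+ (N - 1 - 2 * k))) => <-.
by rewrite mul1r; apply: eq_bigr => k _; rewrite mulrA.
Qed.

(** The hypothesis on [u] and [q] allows both cases in use: both equal to ['X], or both equal to
    1. *)
Lemma word_gf_Eser_xi (u : {poly xser}) (q : {poly int}) n :
  (forall g f k, word_gf g f -> word_gf (g * u ^+ k) (fun s => f s * q ^+ k)) ->
  word_gf ((Eser u * xi_series) n) (fun s => (size s == n)%:R * prefix_sum q s).
Proof.
move=> Gu; have G (i : 'I_n.+1) :=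
  Gu _ _ i (word_gf_wordsM i (sorted gtn) (word_gf_xi (n - i))).
have -> : (Eser u * xi_series) n = \sum_(i < n.+1)
   (words (fun s => (size s == i) && sorted gtn s))%:P * xi_series (n - i)%N * u ^+ i.
  by apply: eq_bigr => i _; rewrite /Eser elemE mulrAC.
apply: eq_word_gf (word_gf_sum _ G) => s.
have [ss|ns] := eqVneq (size s) n.
  rewrite mul1r /prefix_sum ss; apply: eq_bigr => i _.
  rewrite size_drop ss eqxx mul1r -[(i <= n)%N]/(i < n.+1)%N ltn_ord; ring.
rewrite mul0r big1 // => i _; case: ifP => lei; last by rewrite mul0r.
rewrite size_drop (_ : (_ == _) = false) ?mul0r ?mulr0 ?mul0r //.
by apply/negbTE; apply: contra ns => /eqP e; apply/eqP; have := ltn_ord i; lia.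
Qed.

Lemma Eser_tz_xi : Eser 'X * xi_series = gamma_series.
Proof.
apply/funext => n; apply: word_gf_uniq (word_gf_gamma n) _.
  by apply: (@word_gf_Eser_xi _ 'X) => g f k; exact: word_gfMXn.
by move=> s; rewrite prefix_sumX.
Qed.

Lemma zconstM (R : comNzRingType) (c : R) (f : zser R) n : (zconst c * f) n = c * f n.
Proof.
rewrite -[LHS]/(\sum_(i < n.+1) zconst c i * f (n - i)%N) big_ord_recl subn0 big1 ?addr0 //.
by move=> i _; rewrite mul0r.
Qed.

Lemma Eser_z_xi : zconst 'X * (Eser 1 * xi_series) = gamma_series - zconst (1 - 'X).
Proof.
apply/funext => n; rewrite zconstM -[RHS]/(gamma_series n - zconst (1 - 'X) n).
have G1 : word_gf ((Eser 1 * xi_series) n) (fun s => (size s == n)%:R * prefix_sum 1 s).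
  apply: word_gf_Eser_xi => g f k G; rewrite expr1n mulr1.
  by apply: eq_word_gf G => s; rewrite expr1n mulr1.
case: n G1 => [_|n G1].
  (* Degree 0 holds only the empty word, the exceptional case of [prefix_sum1]; it accounts for
     [1 - 'X]. *)
  have -> : (Eser 1 * xi_series) 0%N = 1.
    rewrite -[LHS]/(\sum_(i < 1) Eser 1 i * xi_series (0 - i)%N) big_ord1 /Eser elem0.
    by rewrite mulr1 mul1r; exact: addr0.
  have -> : gamma_series 0%N = 1 by exact: addr0.
  by rewrite /zconst /=; ring.
rewrite subr0 mulrC; apply: word_gf_uniq (word_gfMX G1) (word_gf_gamma n.+1) _ => -[|x s].
  by rewrite !mul0r.
by rewrite -mulrA [prefix_sum _ _ * _]mulrC prefix_sum1.
Qed.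

(** * Uniqueness of the quotients *)

Lemma zser_lreg (R : comNzRingType) (f : zser R) : GRing.lreg (f 0%N) -> GRing.lreg f.
Proof.
move=> f0 g h /eqP; rewrite -subr_eq0 -mulrBr => /eqP fd.
apply/eqP; rewrite -subr_eq0; apply/eqP; set d := g - h in fd *.
(* Once the lower coefficients of [d] vanish, the coefficient of degree [n] in [f * d] is
   [f 0 * d n]. *)
apply/funext => n; elim/ltn_ind: n => n IH; apply: f0.
have := congr1 (@^~ n) fd; rewrite -[X in X = _ -> _]/(\sum_(i < n.+1) f i * d (n - i)%N).
rewrite big_ord_recl subn0 big1 ?addr0 => [->|i _]; first by rewrite mulr0.
by rewrite IH ?mulr0 //; rewrite lift0; have := ltn_ord i; lia.
Qed.

Lemma is_quot_lreg (R : comNzRingType) (a b c : R) : GRing.lreg b -> b * c = a ->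
  is_quot a b c.
Proof. by move=> rb <- q; split=> [/rb|->]. Qed.

(** The constant coefficient is [1 - 'X], not invertible but cancellable, being the opposite of a
    monic polynomial. *)
Lemma denominator_lreg : GRing.lreg (Eser 'X - zconst 'X * Eser 1 : zser {poly xser}).
Proof.
apply: zser_lreg; rewrite -[X in GRing.lreg X]/(Eser 'X 0%N - (zconst 'X * Eser 1) 0%N).
rewrite zconstM /Eser elem0 !expr0 !mulr1 -opprB => p q /eqP.
by rewrite !mulNr eqr_opp => /eqP; apply: monic_lreg; exact: monicXsubC.
Qed.

(* t is the polynomial variable 'X *)
Theorem corollary4p1 :
  [/\ is_quot (zconst (1 - 'X)) (Eser 'X - zconst 'X * Eser 1)
        (1 + zsum_from 2 (fun n =>
           \sum_(k < ((n - 2) %/ 2).+1)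
              (xi n k)%:P * 'X ^+ k.+1 * (1 + 'X) ^+ (n - 2 * k - 2))),
      is_quot (zconst (1 - 'X) * Eser 'X) (Eser 'X - zconst 'X * Eser 1)
        (1 + zsum_from 1 (fun n =>
           \sum_(k < ((n - 1) %/ 2).+1)
              (gamma n k)%:P * 'X ^+ k.+1 * (1 + 'X) ^+ (n - 1 - 2 * k))),
      forall n k : nat, (2 <= n)%N ->
        xi n k = \sum_(w : 'S_n | (Asc (w^-1)%g \in Stab (itv n 2 (n - 2)))
                                  && (#|Asc (w^-1)%g| == k)) Fqsym (Des w)
    & forall n k : nat, (1 <= n)%N ->
        gamma n k = \sum_(w : 'S_n | (Asc (w^-1)%g \in Stab (itv n 1 (n - 2)))
                                     && (#|Asc (w^-1)%g| == k)) Fqsym (Des w)].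
Proof.
(* [Eser_tz_xi] and [Eser_z_xi] both produce [gamma_series], which cancels. *)
have quot_xi : (Eser 'X - zconst 'X * Eser 1) * xi_series = zconst (1 - 'X).
  by rewrite mulrBl -mulrA Eser_tz_xi Eser_z_xi opprB addrC subrK.
split.
- exact: is_quot_lreg denominator_lreg quot_xi.
(* Multiplying [quot_xi] by [Eser 'X] turns [xi_series] into [gamma_series]. *)
- apply: is_quot_lreg denominator_lreg _; rewrite -[X in _ * X]/gamma_series.
  by rewrite -Eser_tz_xi mulrCA quot_xi mulrC.
- move=> n k _; rewrite xi_words.
  by rewrite -(standardization (fun A => (A \in Stab (itv n 2 (n - 2))) && (#|A| == k))).
- move=> n k _; rewrite gamma_words.
  by rewrite -(standardization (fun A => (A \in Stab (itv n 1 (n - 2))) && (#|A| == k))).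
Qed.
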